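(* For every $n\ge1$, $\widehat{\mathrm{P}}^{\mathrm{UVAL}_n}=\widehat{\mathrm{P}}^{\mathrm{USAT}_n}$.
   Context: $\Sigma=\{0,1\}$, $\Sigma^*$ the finite nonempty binary strings; for $x\in\Sigma^m$, $\pi_1(x)=x_1$. $\mathbb{P}_+\Sigma=\{\{0\},\{1\},\Sigma\}$. A promise problem is $\phi:\Sigma^*\to\mathbb{P}_+\Sigma$. A $\phi$-oracle Turing machine may, given $x$, obtain in unit time some $y\in\phi(x)$; when $\phi(x)=\Sigma$ the returned value is nondeterministic (adversarial), independently on each call. $\phi_1\propto_T\phi_2$ means there is a $\phi_2$-oracle Turing machine $M$ and a polynomial $p$ such that on every input $x$ every possible computation path halts within $p(|x|)$ steps and outputs an element of $\phi_1(x)$. $\widehat{\mathrm{P}}^{\phi}=\{\phi_1:\phi_1\propto_T\phi\}$. Level-$n$ problems: the input encodes (e.g. as a Boolean formula) $f:\Sigma^{m_1}\times\dots\times\Sigma^{m_n}\to\Sigma$, written $f(x,\dots)$ with $x\in\Sigma^{m_1}$; $f_x$ is $f$ with $x$ fixed. For a constant $c$, $\mathrm{SAT}_0(c)=\overline{\mathrm{SAT}}_0(c)=c$; for $n\ge1$, $\mathrm{SAT}_n(f)=1\iff\exists x:\overline{\mathrm{SAT}}_{n-1}(f_x)=1$, $\overline{\mathrm{SAT}}_n(f)=1\iff\forall x,\ \mathrm{SAT}_{n-1}(f_x)=1$; $\mathrm{USAT}_n(f)=\{\mathrm{SAT}_n(f)\}$ if $|\{x:\overline{\mathrm{SAT}}_{n-1}(f_x)=1\}|\le1$,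 else $\Sigma$; $\mathrm{UVAL}_n(f)=\{\pi_1x:\overline{\mathrm{SAT}}_{n-1}(f_x)=1\}$ if there is exactly one $x$ with $\overline{\mathrm{SAT}}_{n-1}(f_x)=1$, else $\Sigma$. *)

(* Defs.v *)
From mathcomp Require Import all_boot.
From Stdlib Require Import ClassicalEpsilon.
Set Implicit Arguments. Unset Strict Implicit. Unset Printing Implicit Defensive.

(* The three nonempty subsets {0}, {1}, Sigma of Sigma = {0,1} (0 = false). *)
Inductive pset := Only (b : bool) | Both.
Definition mem_p (S : pset) (b : bool) : bool :=
  match S with Only c => b == c | Both => true end.

(* A promise problem phi : Sigma^* -> P_+ Sigma.  Binary strings are seq bool;
   only nonempty strings are treated as inputs (see [reduces]). *)
Definition promise := seq bool -> pset.

(* tape symbols: Some b = bit b, None = blank *)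
Definition sym := option bool.
Inductive dir := DL | DR | DS.

(* Actions of the transition function:
   - Move q w d a : go to state q, write w on the work tape, move the work
     head in direction d, and (if a = Some b) append bit b to the
     (write-only) query tape;  one step.
   - Ask qno qyes : query the oracle on the current query-tape content y,
     obtain some answer a in phi(y) (chosen adversarially), go to state
     qyes if a = 1 and qno if a = 0, and erase the query tape; one step.
   - Stop b : halt with output b. *)
Inductive action (Q : Type) :=
  | Move of Q & sym & dir & option bool
  | Ask of Q & Q
  | Stop of bool.

Record OTM := {
  state : finType;
  start : state;
  delta : state -> sym -> action state }.

(* configuration: state, work tape as zipper (left part reversed, scanned
   symbol, right part; blanks beyond), query tape content *)
Record config (M : OTM) := Config {
  cst : state M; cleft : seq sym; ccur : sym; cright : seq sym; cquery : seq bool }.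

Definition move_tape (d : dir) (l : seq sym) (c : sym) (r : seq sym)
  : seq sym * sym * seq sym :=
  match d with
  | DS => (l, c, r)
  | DL => match l with [::] => ([::], None, c :: r) | a :: l' => (l', a, c :: r) end
  | DR => match r with [::] => (c :: l, None, [::]) | a :: r' => (c :: l, a, r') end
  end.

Definition init (M : OTM) (x : seq bool) : config M :=
  match x with
  | [::] => Config (start M) [::] None [::] [::]
  | b :: bs => Config (start M) [::] (Some b) (map Some bs) [::]
  end.

Fixpoint halts_ok (M : OTM) (phi : promise) (P : bool -> bool) (t : nat)
  (c : config M) {struct t} : Prop :=
  match delta (cst c) (ccur c) with
  | Stop b => P b
  | Move q w d a =>
      match t with
      | 0 => False
      | t'.+1 =>
          let: (l', c', r') := move_tape d (cleft c) w (cright c) in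
          halts_ok phi P t'
            (Config q l' c' r' (cquery c ++ (if a is Some b then [:: b] else [::])))
      end
  | Ask qno qyes =>
      match t with
      | 0 => False
      | t'.+1 =>
          forall ans : bool, mem_p (phi (cquery c)) ans ->
            halts_ok phi P t'
              (Config (if ans then qyes else qno) (cleft c) (ccur c) (cright c) [::])
      end
  end.

Definition peval (p : seq nat) (n : nat) : nat :=
  \sum_(i < size p) nth 0 p i * n ^ i.

Definition reduces (phi1 phi2 : promise) : Prop :=
  exists (M : OTM) (p : seq nat),
    forall x : seq bool, x != [::] ->
      @halts_ok M phi2 (mem_p (phi1 x)) (peval p (size x)) (init M x).

Definition Phat (phi : promise) : promise -> Prop := fun phi1 => reduces phi1 phi.

(* FVar i j is the j-th bit (0-based) of the i-th argument block (0-based). *)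
Inductive form :=
  | FVar of nat & nat
  | FConst of bool
  | FNot of form
  | FAnd of form & form
  | FOr of form & form.

Fixpoint eval (f : form) (rho : nat -> nat -> bool) : bool :=
  match f with
  | FVar i j => rho i j
  | FConst b => b
  | FNot g => ~~ eval g rho
  | FAnd g h => eval g rho && eval h rho
  | FOr g h => eval g rho || eval h rho
  end.

Fixpoint vars_ok (ms : seq nat) (f : form) : bool :=
  match f with
  | FVar i j => (i < size ms) && (j < nth 0 ms i)
  | FConst _ => true
  | FNot g => vars_ok ms g
  | FAnd g h | FOr g h => vars_ok ms g && vars_ok ms h
  end.

(* a valid level-n instance: f : Sigma^{m_1} x ... x Sigma^{m_n} -> Sigma,
   ms = [:: m_1; ...; m_n], all m_i >= 1 *)
Definition valid (n : nat) (ms : seq nat) (f : form) : bool :=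
  (size ms == n) && all (fun m => 0 < m) ms && vars_ok ms f.

Definition tTICK := [:: false; false; false].
Definition tSEP  := [:: false; false; true].
Definition tVAR  := [:: false; true; false].
Definition tC0   := [:: false; true; true].
Definition tC1   := [:: true; false; false].
Definition tNOT  := [:: true; false; true].
Definition tAND  := [:: true; true; false].
Definition tOR   := [:: true; true; true].
Definition unary (k : nat) : seq bool := flatten (nseq k tTICK).

Fixpoint enc_form (f : form) : seq bool :=
  match f with
  | FVar i j => tVAR ++ unary i ++ tSEP ++ unary j ++ tSEP
  | FConst b => if b then tC1 else tC0
  | FNot g => tNOT ++ enc_form g
  | FAnd g h => tAND ++ enc_form g ++ enc_form h
  | FOr g h => tOR ++ enc_form g ++ enc_form h
  end.

Definition enc (ms : seq nat) (f : form) : seq bool :=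
  flatten [seq tSEP ++ unary m | m <- ms] ++ enc_form f.

(* decoding (the encoding is injective, so the choice is unique) *)
Definition decode (n : nat) (x : seq bool) : option (seq nat * form) :=
  match excluded_middle_informative
          (exists p : seq nat * form, valid n p.1 p.2 /\ enc p.1 p.2 = x) with
  | left H => Some (proj1_sig (constructive_indefinite_description _ H))
  | right _ => None
  end.

Definition upd (rho : nat -> nat -> bool) (d m : nat) (x : m.-tuple bool) :=
  fun i j => if i == d then nth false x j else rho i j.

Definition rho0 : nat -> nat -> bool := fun _ _ => false.

(* [Qsat ex d ms f rho]: with blocks 0..d-1 fixed by rho and the remaining
   blocks of sizes ms: if ex, SAT_{|ms|}(f_rho), else coSAT_{|ms|}(f_rho). *)
Fixpoint Qsat (ex : bool) (d : nat) (ms : seq nat) (f : form)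
  (rho : nat -> nat -> bool) : bool :=
  match ms with
  | [::] => eval f rho
  | m :: ms' =>
      if ex then [exists x : m.-tuple bool, Qsat false d.+1 ms' f (upd rho d x)]
      else [forall x : m.-tuple bool, Qsat true d.+1 ms' f (upd rho d x)]
  end.

Definition SATn (ms : seq nat) (f : form) : bool := Qsat true 0 ms f rho0.

Definition USATval (ms : seq nat) (f : form) : pset :=
  match ms with
  | [::] => Both
  | m :: ms' =>
      let W := [pred x : m.-tuple bool | Qsat false 1 ms' f (upd rho0 0 x)] in
      if #|W| <= 1 then Only (SATn ms f) else Both
  end.

Definition UVALval (ms : seq nat) (f : form) : pset :=
  match ms with
  | [::] => Both
  | m :: ms' =>
      let W := [pred x : m.-tuple bool | Qsat false 1 ms' f (upd rho0 0 x)] in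
      if #|W| == 1 then
        match [pick x in W] with Some x => Only (nth false x 0) | None => Both end
      else Both
  end.

(* strings that do not encode a valid level-n instance are outside the promise *)
Definition USAT (n : nat) : promise := fun x =>
  match decode n x with Some (ms, f) => USATval ms f | None => Both end.

Definition UVAL (n : nat) : promise := fun x =>
  match decode n x with Some (ms, f) => UVALval ms f | None => Both end.

(* Main.v *)
(** Each problem is solved by a program with oracle access to the other one, and
    such a program can be run in place of the oracle of any machine.

    UVAL from USAT: ask [USAT_n] about [f(x, ...) /\ c /\ x_1], where [c] is a fresh
    first bit of [x].  If [x] is the only witness of [f], the new formula has at most
    one witness, and it has one iff [x_1 = 1].

    USAT from UVAL: asking [UVAL_n] about [f(x, ...) /\ (c <-> x_i)] for each [i]
    yields a candidate [a], which is the witness of [f] if there is exactly one.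
    To test whether [a] is a witness, that is whether the opponent has no reply
    refuting [f_a], ask [UVAL_n] about the formula whose witness is [(1, a, 0)] if
    there is no refutation, and [(0, a, w)] for the least refutation [w] otherwise.
    This witness always exists and is unique, and it is checked at level [n - 1]: [w]
    refutes [f_a] and no smaller reply does.  These are two games of the same kind,
    so they share their blocks and the opponent chooses which one is played.

    Programs act on finitely many stacks.  On the tape, the stacks are interleaved to
    the left of a home cell, and the input is consumed from its right end. *)
From HB Require Import structures.
From Stdlib Require Import ZArith Classical.
Require Import Defs.
From mathcomp Require Import all_boot zify.
Set Implicit Arguments. Unset Strict Implicit. Unset Printing Implicit Defensive.

(** * Stack machines on a single tape *)

(** Answers outside the promise do no harm. The query used for UVAL leaves the promise of USAT only
    if [f] does not have exactly one witness, and then both values of UVAL are allowed. In the other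
    direction the bits of [a] may be wrong, but the final query has a unique witness for every [a],
    so its answer is reliable: a positive one exhibits a witness, and a negative one means that
    there is no witness or more than one. That [a] is a witness is a universal statement, whereas
    UVAL reveals one bit of a unique existential witness. The leading flag turns the truth value
    into such a bit. The flag 0 has to be certified by a refutation, and leastness makes that
    certificate unique. Once [w] is fixed, both that it refutes and that no smaller reply does are
    statements that begin with a universal block, so their conjunction stays within the remaining
    blocks. Block sizes are never extracted from the instance: its length bounds them all, and [a]
    gets that many bits. *)

Lemma halts_ok_le (M : OTM) phi P t t' (c : config M) :
  t <= t' -> halts_ok phi P t c -> halts_ok phi P t' c.
Proof.
elim: t t' c => [|t IH] [|t'] c //=; case: (delta _ _) => // q.
- by move=> w d a le_tt'; case: (move_tape _ _ _ _) => -[l c'] r; apply: IH.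
- by move=> q' le_tt' H ans /H; apply: IH.
Qed.

(** * Tapes as functions on the integers *)

Section TapeFunction.

Variables (M : OTM) (phi : promise) (P : bool -> bool).

(* Tape positions are integers increasing to the left. *)
Definition tape_at (G : Z -> sym) (z : Z) (l : seq sym) (c : sym) (r : seq sym) :=
  [/\ c = G z, forall i, nth None l i = G (z + 1 + Z.of_nat i)%Z
    & forall i, nth None r i = G (z - 1 - Z.of_nat i)%Z].

(** Quantifying over all zippers that present the tape [G] identifies lists that differ in trailing
    blanks. *)
Definition ok t st (G : Z -> sym) z q :=
  forall l c r, tape_at G z l c r -> halts_ok phi P t (@Config M st l c r q).

Definition shift (d : dir) : Z :=
  match d with DL => 1 | DR => -1 | DS => 0 end%Z.

Definition updZ (G : Z -> sym) z w : Z -> sym :=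
  fun x => if (x =? z)%Z then w else G x.

Lemma ok_le t t' st G z q : t <= t' -> ok t st G z q -> ok t' st G z q.
Proof. by move=> le_tt' H l c r /H; apply: halts_ok_le. Qed.

Lemma ok_at t t' st G z z' q :
  z = z' -> t <= t' -> ok t st G z q -> ok t' st G z' q.
Proof. by move=> ->; apply: ok_le. Qed.

Lemma ok_ext t st G G' z q : G =1 G' -> ok t st G z q -> ok t st G' z q.
Proof.
by move=> eqG H l c r [-> Hl Hr]; apply: H; split=> // i; rewrite eqG.
Qed.

Lemma ok_translate t st G z d q :
  ok t st (fun x => G (x + d)%Z) z q -> ok t st G (z + d) q.
Proof.
move=> H l c r [Ec Hl Hr]; apply: H; split=> // i.
  by rewrite Hl; congr G; lia.
by rewrite Hr; congr G; lia.
Qed.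

Lemma move_tape_at G z w d l c r : tape_at G z l c r ->
  let: (l', c', r') := move_tape d l w r in
  tape_at (updZ G z w) (z + shift d) l' c' r'.
Proof.
case=> _ Hl Hr; rewrite /tape_at /updZ; case: d => /=.
- case: l Hl => [|a l] Hl; split => [|i|[|i]] /=.
  + by have := Hl 0; rewrite /= ifF; [move=> ->; congr G; lia | lia].
  + have := Hl i.+1; rewrite /= ifF; last lia.
    by rewrite nth_nil => ->; congr G; lia.
  + by rewrite ifT //; lia.
  + by rewrite ifF; [rewrite Hr; congr G; lia | lia].
  + by have := Hl 0; rewrite /= ifF; [move=> ->; congr G; lia | lia].
  + by have := Hl i.+1; rewrite /= ifF; [move=> ->; congr G; lia | lia].
  + by rewrite ifT //; lia.
  + by rewrite ifF; [rewrite Hr; congr G; lia | lia].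
- case: r Hr => [|a r] Hr; split => [|[|i]|i] /=.
  + by have := Hr 0; rewrite /= ifF; [move=> ->; congr G; lia | lia].
  + by rewrite ifT //; lia.
  + by rewrite ifF; [rewrite Hl; congr G; lia | lia].
  + have := Hr i.+1; rewrite /= ifF; last lia.
    by rewrite nth_nil => ->; congr G; lia.
  + by have := Hr 0; rewrite /= ifF; [move=> ->; congr G; lia | lia].
  + by rewrite ifT //; lia.
  + by rewrite ifF; [rewrite Hl; congr G; lia | lia].
  + by have := Hr i.+1; rewrite /= ifF; [move=> ->; congr G; lia | lia].
- split=> [|i|i]; first by rewrite ifT //; lia.
  + by rewrite ifF; [rewrite Hl; congr G; lia | lia].
  + by rewrite ifF; [rewrite Hr; congr G; lia | lia].
Qed.

Lemma ok_move t st st' w d a (G : Z -> sym) z q :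
  delta st (G z) = Move st' w d a ->
  ok t st' (updZ G z w) (z + shift d) (q ++ (if a is Some b then [:: b] else [::])) ->
  ok t.+1 st G z q.
Proof.
move=> E H l c r Ht; have Ec : c = G z by case: Ht.
have := move_tape_at w d Ht.
by rewrite /= Ec E; case: (move_tape _ _ _ _) => -[l' c'] r' /H.
Qed.

Lemma ok_walk t st st' d (G : Z -> sym) z q :
  delta st (G z) = Move st' (G z) d None ->
  ok t st' G (z + shift d) q -> ok t.+1 st G z q.
Proof.
move=> E H; apply: ok_move E _; rewrite cats0.
by apply: ok_ext H => x; rewrite /updZ; case: Z.eqb_spec => [->|].
Qed.

Lemma ok_ask t st qno qyes (G : Z -> sym) z q :
  delta st (G z) = Ask qno qyes ->
  (forall ans, mem_p (phi q) ans -> ok t (if ans then qyes else qno) G z [::]) ->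
  ok t.+1 st G z q.
Proof.
move=> E H l c r Ht; have Ec : c = G z by case: Ht.
rewrite /= Ec E => ans Ha. by apply: (H ans Ha); rewrite -Ec.
Qed.

Lemma ok_stop t st b (G : Z -> sym) z q :
  delta st (G z) = Stop _ b -> P b -> ok t st G z q.
Proof.
move=> E Pb l c r Ht; have Ec : c = G z by case: Ht.
by case: t => [|t] /=; rewrite Ec E.
Qed.

End TapeFunction.

Inductive sinstr (K : nat) (Q : Type) :=
  | SPush of 'I_K & bool & Q
  | SPop of 'I_K & (option bool -> Q)
  | SRead of (option bool -> Q)
  | SEmit of bool & Q
  | SAsk of (bool -> Q)
  | SJump of Q
  | SStop of bool.

Arguments SRead {K Q}.
Arguments SEmit {K Q}.
Arguments SAsk {K Q}.
Arguments SJump {K Q}.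
Arguments SStop {K Q}.

Section StackMachine.

Variables (K : nat) (Q : finType) (q0 : Q) (ins : Q -> sinstr K Q).
Variables (phi : promise) (P : bool -> bool).

Fixpoint shalts t q (inp : seq bool) (stk : seq (seq bool)) (y : seq bool) : Prop :=
  match ins q, t with
  | SStop b, _ => P b
  | _, 0 => False
  | SPush i b q', t'.+1 =>
      shalts t' q' inp (set_nth [::] stk i (b :: nth [::] stk i)) y
  | SPop i k, t'.+1 =>
      shalts t' (k (ohead (nth [::] stk i))) inp
        (set_nth [::] stk i (behead (nth [::] stk i))) y
  | SRead k, t'.+1 => shalts t' (k (ohead inp)) (behead inp) stk y
  | SEmit b q', t'.+1 => shalts t' q' inp stk (rcons y b)
  | SAsk k, t'.+1 =>
      forall ans, mem_p (phi y) ans -> shalts t' (k ans) inp stk [::]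
  | SJump q', t'.+1 => shalts t' q' inp stk y
  end.

Lemma shalts_le t t' q inp stk y :
  t <= t' -> shalts t q inp stk y -> shalts t' q inp stk y.
Proof.
elim: t t' q inp stk y => [|t IH] [|t'] q inp stk y //=; case: (ins q) => //.
all: try by move=> *; apply: IH; eauto.
Qed.

(** The counter of [Lft], [Bck] and [Rgt] is the number of cells to cross before the next
    inspection; its largest value is [K.+1], the period of the tracks. [Lft] climbs a track, [Bck]
    steps down by one element, [Rgt] returns to the home cell, and the [In] states fetch and erase
    the last input symbol. *)
Inductive ost :=
  | Ini of bool
  | Mark
  | Home of Q
  | Lft of Q & bool & 'I_K.+2
  | Bck of Q & 'I_K.+2
  | Rgt of Q & 'I_K.+2
  | InGap of Q
  | InFst of Q
  | InEnd of Q
  | InGet of Q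
  | InRet of Q.

Definition ost_code (s : ost) :
  bool + unit + (Q + Q * bool * 'I_K.+2 + (Q * 'I_K.+2 + Q * 'I_K.+2))
       + (Q + Q + (Q + Q + Q)) :=
  match s with
  | Ini b => inl (inl (inl b))
  | Mark => inl (inl (inr tt))
  | Home q => inl (inr (inl (inl q)))
  | Lft q b k => inl (inr (inl (inr (q, b, k))))
  | Bck q k => inl (inr (inr (inl (q, k))))
  | Rgt q k => inl (inr (inr (inr (q, k))))
  | InGap q => inr (inl (inl q))
  | InFst q => inr (inl (inr q))
  | InEnd q => inr (inr (inl (inl q)))
  | InGet q => inr (inr (inl (inr q)))
  | InRet q => inr (inr (inr q))
  end.

Definition ost_decode s : ost :=
  match s with
  | inl (inl (inl b)) => Ini b
  | inl (inl (inr tt)) => Mark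
  | inl (inr (inl (inl q))) => Home q
  | inl (inr (inl (inr (q, b, k)))) => Lft q b k
  | inl (inr (inr (inl (q, k)))) => Bck q k
  | inl (inr (inr (inr (q, k)))) => Rgt q k
  | inr (inl (inl q)) => InGap q
  | inr (inl (inr q)) => InFst q
  | inr (inr (inl (inl q))) => InEnd q
  | inr (inr (inl (inr q))) => InGet q
  | inr (inr (inr q)) => InRet q
  end.

Lemma ost_codeK : cancel ost_code ost_decode. Proof. by case. Qed.

HB.instance Definition _ := Equality.copy ost (can_type ost_codeK).
HB.instance Definition _ := Choice.copy ost (can_type ost_codeK).
HB.instance Definition _ := Countable.copy ost (can_type ost_codeK).
HB.instance Definition _ := Finite.copy ost (can_type ost_codeK).

Definition odelta (s : ost) (c : sym) : action ost :=
  match s with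
  | Ini b => Move (if b then Mark else Ini true) c DL None
  | Mark => Move (Home q0) (Some true) DS None
  | Home q =>
      match ins q with
      | SPush i _ _ | SPop i _ => Move (Lft q true (inord i.+1)) c DS None
      | SRead _ => Move (InGap q) c DR None
      | SEmit b q' => Move (Home q') c DS (Some b)
      | SAsk k => Ask (Home (k false)) (Home (k true))
      | SJump q' => Move (Home q') c DS None
      | SStop b => Stop _ b
      end
  | Lft q first k =>
      if k == 0 :> nat then
        match ins q, c with
        | SPush i b q', None => Move (Rgt q' (inord i.+1)) (Some b) DS None
        | SPop i kq, None =>
            if first then Move (Rgt (kq None) (inord i.+1)) None DS None
            else Move (Bck q (inord K.+1)) c DS None
        | _, _ => Move (Lft q false (inord K)) c DL None
        end
      else Move (Lft q first (inord k.-1)) c DL None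
  | Bck q k =>
      if k == 0 :> nat then
        match ins q with
        | SPop i kq => Move (Rgt (kq c) (inord i.+1)) None DS None
        | _ => Stop _ true
        end
      else Move (Bck q (inord k.-1)) c DR None
  | Rgt q k =>
      if k == 0 :> nat then
        if c is Some _ then Move (Home q) c DS None
        else Move (Rgt q (inord K)) c DR None
      else Move (Rgt q (inord k.-1)) c DR None
  | InGap q => Move (InFst q) c DR None
  | InFst q =>
      if c is Some _ then Move (InEnd q) c DR None
      else if ins q is SRead k then Move (InRet (k None)) c DL None else Stop _ true
  | InEnd q =>
      if c is Some _ then Move (InEnd q) c DR None
      else Move (InGet q) c DL None
  | InGet q =>
      if ins q is SRead k then Move (InRet (k c)) None DL None else Stop _ true
  | InRet q =>
      if c is Some _ then Move (InRet q) c DL None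
      else Move (Home q) c DL None
  end.

Definition otm := {| state := ost; start := Ini false; delta := odelta |}.

Notation W := K.+1.
Notation okM := (@ok otm phi P).

(* Element [j] (from the bottom) of stack [i] is stored [j * W + i + 1] cells to
   the left of the home cell, so that no stack operation ever shifts data. *)
Definition rep (G : Z -> sym) (inp : seq bool) (stk : seq (seq bool)) :=
  [/\ G 0%Z = Some true,
      forall j : nat, G (Z.of_nat (j.+1 * W)) = None,
      forall (i : 'I_K) (j : nat),
        G (Z.of_nat (j * W + i.+1)) = onth (rev (nth [::] stk i)) j,
      G (-1)%Z = None
    & forall j : nat, G (- 2 - Z.of_nat j)%Z = onth (rev inp) j].

Lemma track_inj i i' j j' :
  i < W -> i' < W -> j * W + i = j' * W + i' -> j = j' /\ i = i'.
Proof.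
move=> ltiW lti'W E; split; last first.
  by have := congr1 (modn^~ W) E; rewrite !modnMDl !modn_small.
by have := congr1 (divn^~ W) E; rewrite !divnMDl // !divn_small // !addn0.
Qed.

Lemma rep_set G inp stk (i : 'I_K) (j : nat) w s :
  rep G inp stk ->
  (forall j', onth (rev s) j' =
     if j' == j then w else onth (rev (nth [::] stk i)) j') ->
  rep (updZ G (Z.of_nat (j * W + i.+1)) w) inp (set_nth [::] stk i s).
Proof.
case=> G0 GW Gs Gg Gi Es; rewrite /updZ; split=> [|j'|i' j'||j'].
- by rewrite ifF //; lia.
- rewrite ifF //; apply/negbTE/negP => /Z.eqb_spec /Nat2Z.inj E.
  have := @track_inj 0 i.+1 j'.+1 j; rewrite addn0 => -[] //.
  by rewrite ltnS.
- rewrite nth_set_nth /=; case: Z.eqb_spec => [/Nat2Z.inj E|neq].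
    have [||-> [/ord_inj ->]] := @track_inj i'.+1 i.+1 j' j _ _ E.
    + by rewrite ltnS.
    + by rewrite ltnS.
    + by rewrite eqxx Es eqxx.
  case: eqP => [eq_ii'|_]; last by rewrite Gs.
  rewrite Es Gs eq_ii'; case: eqP => // eq_jj'.
  by case: neq; rewrite eq_jj' eq_ii'.
- by rewrite ifF //; lia.
- by rewrite ifF //; lia.
Qed.

Lemma rep_ext G G' inp stk : G =1 G' -> rep G inp stk -> rep G' inp stk.
Proof.
by move=> E [? ? ? ? ?]; split; rewrite -?E // => *; rewrite -E.
Qed.

Lemma ok_lft t q f k G z y : k <= W ->
  okM t (Lft q f (inord 0)) G (z + Z.of_nat k) y ->
  okM (t + k) (Lft q f (inord k)) G z y.
Proof.
elim: k z => [|k IH] z lekW; first by rewrite addn0 Z.add_0_r.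
move=> H; rewrite addnS.
apply: (@ok_walk otm _ _ _ _ (Lft q f (inord k)) DL).
  by rewrite /= inordK.
by apply: IH; [lia | apply: ok_at H => //=; lia].
Qed.

Lemma ok_bck t q k G z y : k <= W ->
  okM t (Bck q (inord 0)) G (z - Z.of_nat k) y ->
  okM (t + k) (Bck q (inord k)) G z y.
Proof.
elim: k z => [|k IH] z lekW; first by rewrite addn0 Z.sub_0_r.
move=> H; rewrite addnS.
apply: (@ok_walk otm _ _ _ _ (Bck q (inord k)) DR).
  by rewrite /= inordK.
by apply: IH; [lia | apply: ok_at H; rewrite ?/shift; lia].
Qed.

Lemma ok_rgt t q k j G inp stk y : k <= W -> rep G inp stk ->
  okM t (Home q) G 0%Z y ->
  okM (t + 1 + j * W + k) (Rgt q (inord k)) G (Z.of_nat (j * W + k)) y.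
Proof.
move=> lekW [G0 GW _ _ _] H.
elim: j k lekW => [|j IHj]; elim=> [|k IHk] lekW.
- rewrite !addn0 addn1; apply: (@ok_walk otm _ _ _ _ (Home q) DS) => //.
  by rewrite /= inordK // G0.
- rewrite addnS; apply: (@ok_walk otm _ _ _ _ (Rgt q (inord k)) DR).
    by rewrite /= inordK.
  by apply: ok_at (IHk (ltnW lekW)) ; rewrite ?/shift; lia.
- have -> : t + 1 + j.+1 * W + 0 = (t + 1 + j * W + K).+1 by rewrite mulSn; lia.
  apply: (@ok_walk otm _ _ _ _ (Rgt q (inord K)) DR).
    by rewrite /= inordK //= addn0 GW.
  by apply: ok_at (IHj K (leqnSn K)) ; rewrite ?/shift ?mulSn; lia.
- rewrite addnS; apply: (@ok_walk otm _ _ _ _ (Rgt q (inord k)) DR).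
    by rewrite /= inordK.
  by apply: ok_at (IHk (ltnW lekW)) ; rewrite ?/shift; lia.
Qed.

Definition accesses (i : 'I_K) (a : sinstr K Q) :=
  match a with SPush i' _ _ | SPop i' _ => i' == i | _ => false end.

(** The flag [first] survives only if the first inspected cell is already blank. This is how a pop
    tells an empty stack from the blank cell above a top element. *)
Lemma ok_seek t q (i : 'I_K) first j G inp stk y :
  accesses i (ins q) -> rep G inp stk -> j <= size (nth [::] stk i) ->
  okM t (Lft q (first && (j == size (nth [::] stk i))) (inord 0)) G
    (Z.of_nat (size (nth [::] stk i) * W + i.+1)) y ->
  okM (t + (size (nth [::] stk i) - j) * W) (Lft q first (inord 0)) G
    (Z.of_nat (j * W + i.+1)) y.
Proof.
move=> acc [_ _ Gs _ _]; set s := size _.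
move: {2}(s - j) (erefl (s - j)) => d; elim: d j first => [|d IH] j first Ed lejs H.
  have Ej : j = s by lia.
  by move: H; rewrite Ed addn0 -Ej eqxx andbT.
have ltjs : j < s by lia.
have -> : t + (s - j) * W = (t + (s - j.+1) * W + K).+1 by nia.
apply: (@ok_walk otm _ _ _ _ (Lft q false (inord K)) DL).
  rewrite /= inordK //= Gs.
  have [b ->] : exists b, onth (rev (nth [::] stk i)) j = Some b.
    by exists (nth false (rev (nth [::] stk i)) j); rewrite onthE (nth_map false) ?size_rev.
  by move: acc; case: (ins q).
apply: ok_lft => //.
apply: ok_at (IH j.+1 false _ _ _); rewrite ?/shift; [lia|lia|lia|lia|].
by move: H; rewrite (ltn_eqF ltjs) andbF.
Qed.

Lemma ok_enter t q (i : 'I_K) G inp stk y :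
  accesses i (ins q) -> rep G inp stk ->
  okM t (Lft q (0 == size (nth [::] stk i)) (inord 0)) G
    (Z.of_nat (size (nth [::] stk i) * W + i.+1)) y ->
  okM (t + size (nth [::] stk i) * W + i.+1 + 1) (Home q) G 0%Z y.
Proof.
move=> acc HG H; rewrite addn1.
apply: (@ok_walk otm _ _ _ _ (Lft q true (inord i.+1)) DS).
  by move: acc => /=; case: (ins q) => //= i' => [_ _|_] /eqP ->.
apply: ok_lft; first by rewrite ltnS ltnW.
have := @ok_seek t q i true 0 G inp stk y acc HG (leq0n _) H.
by apply: ok_at; rewrite ?subn0 //= /shift; lia.
Qed.

(** The head climbs the track and comes back, crossing fewer than [W * (size + 1)] cells each way;
    the factor 4 absorbs the fixed overhead and the extra steps of a pop. *)
Lemma ok_push t q i b q' G inp stk y : ins q = SPush i b q' -> rep G inp stk ->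
  (forall G', rep G' inp (set_nth [::] stk i (b :: nth [::] stk i)) ->
    okM t (Home q') G' 0%Z y) ->
  okM (t + 4 * W * (size (nth [::] stk i) + 2)) (Home q) G 0%Z y.
Proof.
move=> Eq HG H; set s := size _.
have ltiK : i < K by [].
apply: (@ok_le _ _ _ ((t + 1 + s * W + i.+1).+1 + s * W + i.+1 + 1)); first by nia.
apply: ok_enter (HG) _; first by rewrite Eq /=.
set G' := updZ G (Z.of_nat (s * W + i.+1)) (Some b).
have HG' : rep G' inp (set_nth [::] stk i (b :: nth [::] stk i)).
  apply: rep_set HG _ => j'; rewrite rev_cons -cats1 onth_cat size_rev -/s.
  case: (ltngtP j' s) => // [ltsj'|->]; last by rewrite subnn.
  by rewrite !onth_default //= ?size_rev -/s; lia.
apply: (@ok_move otm _ _ _ _ (Rgt q' (inord i.+1)) (Some b) DS None).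
  case: HG => _ _ Gs _ _.
  by rewrite /= inordK //= Eq Gs onth_default // size_rev.
rewrite cats0 Z.add_0_r; apply: ok_rgt (HG') _; first by rewrite ltnS ltnW.
exact: H.
Qed.

Lemma ok_pop t q i k G inp stk y : ins q = SPop i k -> rep G inp stk ->
  (forall G', rep G' inp (set_nth [::] stk i (behead (nth [::] stk i))) ->
    okM t (Home (k (ohead (nth [::] stk i)))) G' 0%Z y) ->
  okM (t + 4 * W * (size (nth [::] stk i) + 2)) (Home q) G 0%Z y.
Proof.
move=> Eq HG H; have ltiK : i < K by [].
have acc : accesses i (ins q) by rewrite Eq /=.
have [_ _ Gs _ _] := HG.
have Gtop : G (Z.of_nat (size (nth [::] stk i) * W + i.+1)) = None.
  by rewrite Gs onth_default // size_rev.
case Es: (nth [::] stk i) H Gtop => [|b s] /= H Gtop.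
  apply: (@ok_le _ _ _ ((t + 1 + 0 * W + i.+1).+1 + 0 * W + i.+1 + 1)); first by nia.
  have := @ok_enter (t + 1 + 0 * W + i.+1).+1 q i G inp stk y acc HG.
  rewrite Es; apply; rewrite [size _]/=.
  apply: (@ok_walk otm _ _ _ _ (Rgt (k None) (inord i.+1)) DS).
    by rewrite [delta _ _]/= inordK // Eq Gtop.
  rewrite Z.add_0_r; apply: ok_rgt (HG) _; first by rewrite ltnS ltnW.
  apply: H; apply: rep_ext (rep_set (j := 0) (w := None) HG _) => [x|j'].
    by rewrite /updZ; case: Z.eqb_spec => // ->.
  by rewrite Es; case: eqP => // ->.
set n := size s.
apply: (@ok_le _ _ _ ((((t + 1 + n * W + i.+1).+1 + K.+1).+1)
  + n.+1 * W + i.+1 + 1)); first by nia.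
have := @ok_enter (((t + 1 + n * W + i.+1).+1 + K.+1).+1) q i G inp stk y acc HG.
rewrite Es; apply; rewrite [size _]/= -/n.
(* The head is on the blank above the top element, which lies one period, [W] cells, back to the
   right. *)
apply: (@ok_walk otm _ _ _ _ (Bck q (inord K.+1)) DS).
  by rewrite [delta _ _]/= inordK //= Eq Gtop.
rewrite Z.add_0_r; apply: ok_bck => //.
have Gn : G (Z.of_nat (n * W + i.+1)) = Some b.
  by rewrite Gs Es rev_cons -cats1 onth_cat size_rev ltnn subnn.
have HG' : rep (updZ G (Z.of_nat (n * W + i.+1)) None) inp (set_nth [::] stk i s).
  apply: rep_set HG _ => j'; rewrite Es rev_cons -cats1 onth_cat size_rev -/n.
  case: (ltngtP j' n) => // [ltnj'|->]; last by rewrite onth_default ?size_rev.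
  by rewrite !onth_default //= ?size_rev -/n; lia.
have H2 : okM (t + 1 + n * W + i.+1).+1 (Bck q (inord 0)) G (Z.of_nat (n * W + i.+1)) y.
  apply: (@ok_move otm _ _ _ _ (Rgt (k (Some b)) (inord i.+1)) None DS None).
    by rewrite [delta _ _]/= inordK //= Eq Gn.
  by rewrite cats0 Z.add_0_r; apply: ok_rgt (HG') _; [rewrite ltnS ltnW | apply: H].
by apply: ok_at H2; rewrite ?mulSn; lia.
Qed.

Lemma ok_emit t q b q' G y : ins q = SEmit b q' ->
  okM t (Home q') G 0%Z (rcons y b) -> okM t.+1 (Home q) G 0%Z y.
Proof.
move=> Eq H; apply: (@ok_move otm _ _ _ _ (Home q') (G 0%Z) DS (Some b)).
  by rewrite /= Eq.
rewrite cats1; apply: ok_ext H => x.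
by rewrite /updZ; case: Z.eqb_spec => // ->.
Qed.

Lemma ok_inret t q G inp stk n y : rep G inp stk -> n <= size inp ->
  okM t (Home q) G 0%Z y ->
  okM (t + 1 + n) (InRet q) G (- 1 - Z.of_nat n)%Z y.
Proof.
move=> [_ _ _ Gg Gi] len H; elim: n len => [|n IH] len.
  rewrite addn0 addn1; apply: (@ok_walk otm _ _ _ _ (Home q) DL) => //=.
  by rewrite Gg.
rewrite addnS; apply: (@ok_walk otm _ _ _ _ (InRet q) DL).
  have -> : (- 1 - Z.of_nat n.+1 = - 2 - Z.of_nat n)%Z by lia.
  have [c Ec] : exists c, onth (rev inp) n = Some c.
    by exists (nth false (rev inp) n); rewrite onthE (nth_map false) ?size_rev.
  by rewrite /= Gi Ec.
by apply: ok_at (IH (ltnW len)); rewrite ?/shift; lia.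
Qed.

Lemma ok_inend t q G inp stk n y : rep G inp stk -> n <= size inp ->
  okM t (InGet q) G (- 1 - Z.of_nat (size inp))%Z y ->
  okM (t + 1 + (size inp - n)) (InEnd q) G (- 2 - Z.of_nat n)%Z y.
Proof.
move=> [_ _ _ Gg Gi]; move Ed: (size inp - n) => d.
elim: d n Ed => [|d IH] n Ed len H.
  have -> : n = size inp by lia.
  rewrite addn0 addn1; apply: (@ok_walk otm _ _ _ _ (InGet q) DL).
    by rewrite Gi onth_default ?size_rev.
  by apply: ok_at H; rewrite ?/shift; lia.
rewrite addnS; apply: (@ok_walk otm _ _ _ _ (InEnd q) DR).
  have [c Ec] : exists c, onth (rev inp) n = Some c.
    exists (nth false (rev inp) n); rewrite onthE (nth_map false) ?size_rev //.
    by lia.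
  by rewrite Gi Ec.
by apply: ok_at (IH n.+1 _ _ H); rewrite ?/shift; lia.
Qed.

Lemma ok_read t q k G inp stk y : ins q = SRead k -> rep G inp stk ->
  (forall G', rep G' (behead inp) stk -> okM t (Home (k (ohead inp))) G' 0%Z y) ->
  okM (t + 2 * (size inp) + 6) (Home q) G 0%Z y.
Proof.
move=> Eq HG; have [G0 GW Gs Gg Gi] := HG; case: inp HG Gi => [|b s] HG Gi /= H.
  rewrite /= !addnS muln0 !addn0.
  apply: (@ok_walk otm _ _ _ _ (InGap q) DR); first by rewrite /= Eq.
  apply: (@ok_walk otm _ _ _ _ (InFst q) DR) => //.
  have G2 : G (0 + shift DR + shift DR)%Z = None.
    by have := Gi 0; rewrite /= => <-.
  apply: (@ok_walk otm _ _ _ _ (InRet (k None)) DL); first by rewrite G2 /= Eq.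
  have := @ok_inret t (k None) G [::] stk 0 y HG isT (H _ HG).
  by apply: ok_at; rewrite ?/shift; lia.
set n := size s.
apply: (@ok_le _ _ _ ((t + 1 + n).+1 + 1 + (n.+1 - 1)).+3); first by lia.
apply: (@ok_walk otm _ _ _ _ (InGap q) DR); first by rewrite /= Eq.
apply: (@ok_walk otm _ _ _ _ (InFst q) DR) => //.
have Gn : G (- 2 - Z.of_nat n)%Z = Some b.
  by rewrite Gi rev_cons -cats1 onth_cat size_rev ltnn subnn.
have G2 : exists c, G (0 + shift DR + shift DR)%Z = Some c.
  exists (nth false (rev (b :: s)) 0); have := Gi 0.
  by rewrite onthE (nth_map false) ?size_rev // => <-.
apply: (@ok_walk otm _ _ _ _ (InEnd q) DR); first by case: G2 => c /= ->.
have := @ok_inend (t + 1 + n).+1 q G (b :: s) stk 1 y HG isT.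
have HG' : rep (updZ G (- 2 - Z.of_nat n)%Z None) s stk.
  rewrite /updZ; split=> [|j|i j||j].
  - by rewrite ifF //; lia.
  - by rewrite ifF //; lia.
  - by rewrite ifF //; lia.
  - by rewrite ifF //; lia.
  - case: Z.eqb_spec => [E|E]; first by rewrite onth_default // size_rev -/n; lia.
    rewrite Gi rev_cons -cats1 onth_cat size_rev -/n; case: ltnP => // lenj.
    by rewrite !onth_default ?size_rev //=; lia.
move=> H1; apply: ok_at (H1 _); rewrite ?/shift; [lia|by []|].
apply: (@ok_move otm _ _ _ _ (InRet (k (Some b))) None DL None).
  have -> : (- 1 - Z.of_nat (size (b :: s)) = - 2 - Z.of_nat n)%Z by rewrite [size _]/= -/n; lia.
  by rewrite /= Eq Gn.
have -> : (- 1 - Z.of_nat (size (b :: s)) = - 2 - Z.of_nat n)%Z by rewrite [size _]/= -/n; lia.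
rewrite cats0; have := ok_inret HG' (leqnn _) (H _ HG').
by apply: ok_at; rewrite ?/shift -/n; lia.
Qed.

(** A stack gains at most one bit per instruction, so its height plus the remaining time never
    increases. [N] bounds this sum, and with it the cost of each simulated instruction. *)
Lemma ok_shalts N t q inp stk y G :
  shalts t q inp stk y -> rep G inp stk ->
  size inp <= N -> (forall i : 'I_K, size (nth [::] stk i) + t <= N) ->
  okM (t * (4 * W * (N + 3))) (Home q) G 0%Z y.
Proof.
elim: t q inp stk y G => [|t IH] q inp stk y G.
  move=> /=; case Eq: (ins q) => //= Pb _ _ _.
  by apply: (@ok_stop otm) Pb; rewrite /= Eq.
rewrite /shalts -/shalts; case Eq: (ins q) => [i b q'|i k|k|b q'|k|q'|b] H HG leI leN.
- apply: (@ok_le _ _ _ (t * (4 * W * (N + 3)) + 4 * W * (size (nth [::] stk i) + 2))).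
    by rewrite mulSn addnC leq_add2r leq_mul2l; have := leN i; lia.
  apply: ok_push Eq HG _ => G' HG'; apply: IH H HG' leI _ => i'.
  rewrite nth_set_nth /=; case: eqP => [/ord_inj _|_] /=.
    by have := leN i; lia.
  by have := leN i'; lia.
- apply: (@ok_le _ _ _ (t * (4 * W * (N + 3)) + 4 * W * (size (nth [::] stk i) + 2))).
    by rewrite mulSn addnC leq_add2r leq_mul2l; have := leN i; lia.
  apply: ok_pop Eq HG _ => G' HG'; apply: IH H HG' leI _ => i'.
  rewrite nth_set_nth /=; case: eqP => [_|_].
    rewrite size_behead; by have := leN i; lia.
  by have := leN i'; lia.
- apply: (@ok_le _ _ _ (t * (4 * W * (N + 3)) + 2 * size inp + 6)).
    by rewrite mulSn -addnA addnC leq_add2r; nia.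
  apply: ok_read Eq HG _ => G' HG'; apply: IH H HG' _ _.
    by rewrite size_behead; lia.
  by move=> i'; have := leN i'; lia.
- apply: (@ok_le _ _ _ (t * (4 * W * (N + 3))).+1); first by rewrite mulSn; nia.
  by apply: ok_emit Eq _; apply: IH H HG leI _ => i; have := leN i; lia.
- apply: (@ok_le _ _ _ (t * (4 * W * (N + 3))).+1); first by rewrite mulSn; nia.
  apply: (@ok_ask otm _ _ _ _ (Home (k false)) (Home (k true))); first by rewrite /= Eq.
  move=> ans /H Hans.
  have : okM (t * (4 * W * (N + 3))) (Home (k ans)) G 0%Z [::].
    by apply: IH Hans HG leI _ => i; have := leN i; lia.
  by case: (ans).
- apply: (@ok_le _ _ _ (t * (4 * W * (N + 3))).+1); first by rewrite mulSn; nia.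
  apply: (@ok_walk otm _ _ _ _ (Home q') DS); first by rewrite /= Eq.
  by apply: IH H HG leI _ => i; have := leN i; lia.
- by apply: (@ok_stop otm) H; rewrite /= Eq.
Qed.

Lemma otm_halts t x : x != [::] -> shalts t q0 (rev x) (nseq K [::]) [::] ->
  halts_ok phi P (t * (4 * W * (t + size x + 3)) + 3) (@init otm x).
Proof.
case: x => // b s _ H.
(* Bit [i] of the input is at position [-i]. The home cell is placed at 2, so that one blank
   separates it from the input. *)
set G := fun z : Z => if (z <=? 0)%Z then onth (b :: s) (Z.to_nat (- z)) else None.
have HG : rep (updZ (fun z => G (z + 2)%Z) 0 (Some true)) (rev (b :: s)) (nseq K [::]).
  rewrite /updZ /G; split=> [|j|i j||j] //.
  - by rewrite nth_nseq if_same /= onth0n ifF; [rewrite ifF //; nia | nia].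
  - rewrite revK ifF; last lia.
    by rewrite ifT; [congr onth|]; lia.
have Hm : okM (t * (4 * W * (t + size (b :: s) + 3)) + 3) (Ini false) G 0%Z [::].
  rewrite addn3.
  apply: (@ok_walk otm _ _ _ _ (Ini true) DL) => //.
  apply: (@ok_walk otm _ _ _ _ Mark DL) => //.
  apply: (@ok_move otm _ _ _ _ (Home q0) (Some true) DS None) => //.
  have -> : (0 + shift DL + shift DL = 0 + 2)%Z by [].
  rewrite cats0 Z.add_0_r; apply: ok_translate.
  have Hr : size (rev (b :: s)) <= t + size (b :: s) by rewrite size_rev leq_addl.
  have Hs (i : 'I_K) : size (nth [::] (nseq K [::]) i : seq bool) + t <= t + size (b :: s).
    by rewrite nth_nseq if_same leq_addr.
  apply: ok_ext (ok_shalts H HG Hr Hs) => z.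
  by rewrite /updZ; case: Z.eqb_spec => [->|]; case: Z.eqb_spec => //; lia.
apply: Hm; split=> [|i|i] //.
- by rewrite nth_nil /G ifF //; lia.
- rewrite /G ifT; last lia.
  have -> : Z.to_nat (- (0 - 1 - Z.of_nat i)) = i.+1 by lia.
  by rewrite /= onthE.
Qed.

End StackMachine.

(** * While programs *)

Definition smap K Q Q' (f : Q -> Q') (a : sinstr K Q) : sinstr K Q' :=
  match a with
  | SPush i b q => SPush i b (f q)
  | SPop i k => SPop i (f \o k)
  | SRead k => SRead (f \o k)
  | SEmit b q => SEmit b (f q)
  | SAsk k => SAsk (f \o k)
  | SJump q => SJump (f q)
  | SStop b => SStop b
  end.

Lemma smap_comp K Q Q' Q'' (f : Q -> Q') (g : Q' -> Q'') (a : sinstr K Q) :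
  smap g (smap f a) = smap (g \o f) a.
Proof. by case: a. Qed.

Inductive cmd (K : nat) (S : Type) :=
  | Do of (S -> sinstr K S)
  | Seq of cmd K S & cmd K S
  | If of (S -> bool) & cmd K S & cmd K S
  | While of (S -> bool) & cmd K S.

Record store (S : Type) := Store {
  mem : S; input : seq bool; stacks : seq (seq bool); query : seq bool }.

Section Run.

Variables (K : nat) (S : Type) (phi : promise).

Definition exec (a : sinstr K S) (u : store S) (R : store S -> Prop) : Prop :=
  let: Store _ inp stk y := u in
  match a with
  | SPush i b s => R (Store s inp (set_nth [::] stk i (b :: nth [::] stk i)) y)
  | SPop i k =>
      R (Store (k (ohead (nth [::] stk i))) inp
           (set_nth [::] stk i (behead (nth [::] stk i))) y)
  | SRead k => R (Store (k (ohead inp)) (behead inp) stk y)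
  | SEmit b s => R (Store s inp stk (rcons y b))
  | SAsk k => forall ans, mem_p (phi y) ans -> R (Store (k ans) inp stk [::])
  | SJump s => R (Store s inp stk y)
  | SStop _ => False
  end.

(* [run c u n R]: whatever the oracle answers, [c] started in [u] terminates
   within [n] steps in a store satisfying [R]. *)
Inductive run : cmd K S -> store S -> nat -> (store S -> Prop) -> Prop :=
  | RunDo f u n (R : store S -> Prop) : exec (f (mem u)) u R -> run (Do f) u n.+1 R
  | RunSeq a b u n m (R' R : store S -> Prop) : run a u n R' ->
      (forall v, R' v -> run b v m R) -> run (Seq a b) u (n + m) R
  | RunIf (test : S -> bool) a b u n R : run (if test (mem u) then a else b) u n R ->
      run (If test a b) u n.+1 R
  | RunDone (test : S -> bool) a u n (R : store S -> Prop) :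
      ~~ test (mem u) -> R u -> run (While test a) u n.+1 R
  | RunLoop (test : S -> bool) a u n m (R' R : store S -> Prop) : test (mem u) ->
      run a u n R' -> (forall v, R' v -> run (While test a) v m R) ->
      run (While test a) u (n + m).+1 R.

Lemma exec_weaken a u (R R' : store S -> Prop) :
  (forall v, R v -> R' v) -> exec a u R -> exec a u R'.
Proof.
move=> HR; case: u => s inp stk y; case: a => //= *; try exact: HR.
by apply: HR; auto.
Qed.

Lemma run_weaken c u n n' (R R' : store S -> Prop) :
  run c u n R -> n <= n' -> (forall v, R v -> R' v) -> run c u n' R'.
Proof.
move=> H; elim: H n' R' => {c u n R}.
- move=> f u n R H [//|n'] R' _ HR; apply: RunDo; exact: exec_weaken H.
- move=> a b u n m R1 R Ha IHa Hb IHb n' R' le_n HR.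
  have -> : n' = n + (n' - n) by lia.
  apply: (RunSeq (IHa n R1 (leqnn _) (fun _ => id))) => v Hv.
  by apply: IHb => //; lia.
- move=> test a b u n R H IH [//|n'] R' le_n HR; apply: RunIf; exact: IH.
- move=> test a u n R t Ru [//|n'] R' _ HR; apply: RunDone => //; exact: HR.
- move=> test a u n m R1 R t Ha IHa Hb IHb [//|n'] R' le_n HR.
  have -> : n' = n + (n' - n) by lia.
  apply: (RunLoop t (IHa n R1 (leqnn _) (fun _ => id))) => v Hv.
  by apply: IHb => //; lia.
Qed.

Lemma run_le c u n n' R : run c u n R -> n <= n' -> run c u n' R.
Proof. by move=> H le_n; apply: run_weaken H le_n _. Qed.

Lemma run_do f u R : exec (f (mem u)) u R -> run (Do f) u 1 R.
Proof. exact: RunDo. Qed.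

(** With the run of the rest as intermediate postcondition, a program can be executed symbolically
    from left to right. *)
Lemma run_seq a b u n m R :
  run a u n (fun v => run b v m R) -> run (Seq a b) u (n + m) R.
Proof. by move=> H; apply: RunSeq H _. Qed.

Lemma run_loop (test : S -> bool) a u n m R : test (mem u) ->
  run a u n (fun v => run (While test a) v m R) -> run (While test a) u (n + m).+1 R.
Proof. by move=> t H; apply: (RunLoop t H). Qed.

End Run.

(** * Polynomial bounds *)

Definition poly_bounded (T : nat -> nat) := exists C k, forall n, T n <= C * n.+1 ^ k.

Lemma poly_boundedC a : poly_bounded (fun=> a).
Proof. by exists a, 0 => n; rewrite expn0 muln1. Qed.

Lemma poly_bounded_id : poly_bounded id.
Proof. by exists 1, 1 => n; rewrite expn1 mul1n. Qed.

Lemma poly_boundedD T T' :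
  poly_bounded T -> poly_bounded T' -> poly_bounded (fun n => T n + T' n).
Proof.
move=> [C [k HT]] [C' [k' HT']]; exists (C + C'), (k + k') => n.
rewrite mulnDl; apply: leq_add.
  by apply: leq_trans (HT n) _; apply: leq_mul => //; rewrite leq_pexp2l ?leq_addr.
by apply: leq_trans (HT' n) _; apply: leq_mul => //; rewrite leq_pexp2l ?leq_addl.
Qed.

Lemma poly_boundedM T T' :
  poly_bounded T -> poly_bounded T' -> poly_bounded (fun n => T n * T' n).
Proof.
move=> [C [k HT]] [C' [k' HT']]; exists (C * C'), (k + k') => n.
by rewrite expnD mulnACA; apply: leq_mul.
Qed.

Lemma poly_bounded_comp T T' :
  poly_bounded T -> poly_bounded T' -> poly_bounded (fun n => T (T' n)).
Proof.
move=> [C [k HT]] [C' [k' HT']]; exists (C * C'.+1 ^ k), (k' * k) => n.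
apply: leq_trans (HT _) _; rewrite -mulnA leq_mul2l expnM -expnMn.
have le1 : (T' n).+1 <= C'.+1 * n.+1 ^ k'.
  by rewrite mulSn; have := HT' n; have : 0 < n.+1 ^ k' by [rewrite expn_gt0]; move: (_ ^ _) (C' * _) => X Y; lia.
by case: k {HT} => [|k]; apply/orP; right; rewrite ?expn0 ?leq_exp2r.
Qed.

Lemma poly_bounded_peval p : poly_bounded (peval p).
Proof.
exists (\sum_(i < size p) nth 0 p i), (size p) => n.
rewrite big_distrl /=; apply: leq_sum => i _; rewrite leq_mul2l; apply/orP; right.
apply: (@leq_trans (n.+1 ^ i)); last by rewrite leq_pexp2l // ltnW.
by case: (nat_of_ord i) => [|k]; rewrite ?expn0 ?leq_exp2r.
Qed.

Lemma peval_of_poly T : poly_bounded T -> exists p, forall n, T n <= peval p n.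
Proof.
(* For [n >= 1] one has [n + 1 <= 2 * n], so the top coefficient [C * 2 ^ k] suffices; at [n = 0]
   the constant coefficient does. *)
move=> [C [k HT]]; exists (nseq k.+1 (C * 2 ^ k)) => n.
apply: leq_trans (HT n) _; rewrite /peval size_nseq.
case: n => [|n].
  rewrite exp1n muln1 big_ord_recl /= muln1; apply: leq_trans (leq_addr _ _).
  by rewrite leq_pmulr // expn_gt0.
rewrite big_ord_recr nth_nseq ltnSn; apply: leq_trans (leq_addl _ _).
rewrite -mulnA leq_mul2l -expnMn; apply/orP; right.
by case: k {HT} => [|k]; rewrite ?expn0 ?leq_exp2r //; lia.
Qed.

(** * Compilation of while programs into stack machines *)

Section Compile.

Variables (K : nat) (S : finType).

(** The [None] of a conditional or a loop is the point where its test is evaluated. In [code], an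
    additional outer [None] is the exit. *)
Fixpoint point (c : cmd K S) : finType :=
  match c with
  | Do _ => unit
  | Seq a b => (point a + point b)%type
  | If _ a b => option (point a + point b)%type
  | While _ a => option (point a)
  end.

Fixpoint entry (c : cmd K S) : point c :=
  match c with
  | Do _ => tt
  | Seq a b => inl (entry a)
  | If _ a b => None
  | While _ a => None
  end.

Fixpoint code (c : cmd K S) : point c -> S -> sinstr K (option (point c) * S) :=
  match c with
  | Do f => fun _ s => smap (pair None) (f s)
  | Seq a b => fun p s =>
      match p with
      | inl p => smap (fun r => (Some (if r.1 is Some p' then inl p' else inr (entry b)),
                                 r.2)) (code p s)
      | inr p => smap (fun r => (omap inr r.1, r.2)) (code p s)
      end
  | If test a b => fun p s =>
      match p with
      | None => SJump (Some (Some (if test s then inl (entry a) else inr (entry b))), s)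
      | Some (inl p) => smap (fun r => (omap (Some \o inl) r.1, r.2)) (code p s)
      | Some (inr p) => smap (fun r => (omap (Some \o inr) r.1, r.2)) (code p s)
      end
  | While test a => fun p s =>
      match p with
      | None => SJump (if test s then Some (Some (entry a)) else None, s)
      | Some p => smap (fun r => (Some r.1, r.2)) (code p s)
      end
  end.

(** The map [e] places the control points of [c] among the states of a larger machine. Being
    arbitrary, it can be composed with the embedding of a subprogram in the induction. *)
Lemma code_run (Q : finType) (ins : Q -> sinstr K Q) phi P c u n R
    (e : option (point c) * S -> Q) t :
  (forall p s, ins (e (Some p, s)) = smap e (code p s)) ->
  run phi c u n R ->
  (forall v, R v ->
    shalts ins phi P t (e (None, mem v)) (input v) (stacks v) (query v)) ->
  shalts ins phi P (t + n) (e (Some (entry c), mem u)) (input u) (stacks u) (query u).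
Proof.
move=> Hins H; elim: H e t Hins => {c u n R}.
- move=> f [s inp stk y] n R /= H e t Hins HR.
  rewrite addnS /= Hins /=.
  have Ht : t <= t + n by apply: leq_addr.
  case: (f s) H => //= [i b s'|i k|k|b s'|k|s'] H; try exact: shalts_le Ht (HR _ H).
  by move=> ans /H Hans; apply: shalts_le Ht (HR _ Hans).
- move=> a b u n m R1 R Ha IHa Hb IHb e t Hins HR.
  rewrite (addnC n) addnA.
  apply: (IHa (fun r => e (Some (if r.1 is Some p' then inl p' else inr (entry b)), r.2)))
    => [p s|v Hv].
    by rewrite Hins /= smap_comp.
  by apply: (IHb v Hv (fun r => e (omap inr r.1, r.2))) => // p s;
    rewrite Hins /= smap_comp.
- move=> test a b u n R H IH e t Hins HR; rewrite addnS /= Hins /=.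
  move: H IH; case: (test _) => H IH.
    by apply: (IH (fun r => e (omap (Some \o inl) r.1, r.2))) => // p s;
      rewrite Hins /= smap_comp.
  by apply: (IH (fun r => e (omap (Some \o inr) r.1, r.2))) => // p s;
    rewrite Hins /= smap_comp.
- move=> test a u n R tF Ru e t Hins HR; rewrite addnS /= Hins /= (negbTE tF).
  by apply: shalts_le (leq_addr _ _) _; apply: HR.
- move=> test a u n m R1 R tT Ha IHa Hb IHb e t Hins HR.
  rewrite addnS /= Hins /= tT (addnC n) addnA.
  apply: (IHa (fun r => e (Some r.1, r.2))) => [p s|v Hv].
    by rewrite Hins /= smap_comp.
  exact: IHb.
Qed.

Definition machine (c : cmd K S) (s0 : S) (out : S -> bool) : OTM :=
  @otm K (option (point c) * S)%type (Some (entry c), s0)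
    (fun q => if q.1 is Some p then code p q.2 else SStop (out q.2)).

Lemma reduces_of_run (c : cmd K S) s0 out phi1 phi2 T :
  poly_bounded T ->
  (forall x, x != [::] -> run phi2 c (Store s0 (rev x) (nseq K [::]) [::]) (T (size x))
    (fun v => mem_p (phi1 x) (out (mem v)))) ->
  reduces phi1 phi2.
Proof.
move=> polyT H.
have [p Hp] : exists p, forall n,
    T n * (4 * K.+1 * (T n + n + 3)) + 3 <= peval p n.
  apply: peval_of_poly; apply: poly_boundedD; last exact: poly_boundedC.
  apply: poly_boundedM => //; apply: poly_boundedM; first exact: poly_boundedC.
  apply: poly_boundedD; last exact: poly_boundedC.
  by apply: poly_boundedD => //; apply: poly_bounded_id.
exists (machine c s0 out), p => x x0.
apply: halts_ok_le (Hp (size x)) _.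
apply: otm_halts => //.
rewrite -[T _]add0n.
apply: (@code_run _ (fun q : option (point c) * S =>
  if q.1 is Some p then code p q.2 else SStop (out q.2)) _ _ c
  (Store s0 (rev x) (nseq K [::]) [::]) _ _ id 0 _ (H x x0)) => [q s|v Hv] //=.
by case: (code q s).
Qed.

End Compile.

(** * Simulating an oracle machine *)

Notation "a ;; b" := (Seq a b) (at level 80, right associativity).
Notation stack i := (@Ordinal 8 i isT).

(* A subroutine receives its argument on stack 2, last bit on top, and leaves
   its answer in its private memory [RM]; [X] is the memory of the caller. *)
Definition solves (RM : Type) (R : forall X : finType, cmd 8 (X * RM))
    (answer : RM -> bool) (phi phi' : promise) (T : nat -> nat) :=
  forall (X : finType) (x : X) (m : RM) inp l r y,
  run phi' (R X) (Store (x, m) inp [:: l, r, rev y & nseq 5 [::]] [::]) (T (size y))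
    (fun v => exists2 m', mem_p (phi y) (answer m') &
       v = Store (x, m') inp [:: l, r, [::] & nseq 5 [::]] [::]).

Section Simulator.

Variables (M : OTM) (RM : finType) (R : forall X : finType, cmd 8 (X * RM)).
Variables (answer : RM -> bool) (phi phi' : promise) (T : nat -> nat).
Hypothesis R_solves : solves R answer phi phi' T.
Hypothesis T_mono : {homo T : m n / m <= n}.

(* current state, scanned symbol, scratch symbol, output once halted *)
Notation X := (state M * sym * sym * option bool)%type.
Notation S := (X * RM)%type.
Implicit Types s : S.

(** Two bits per cell, the upper one telling whether the cell is nonblank. A pop from an empty stack
    is read as a blank too, so the infinite blank part of the tape needs no representation. *)
Definition enc_syms (l : seq sym) : seq bool :=
  flatten [seq [:: isSome c; odflt false c] | c <- l].

Definition act s := let: (q, c, _, _, _) := s in delta q c.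

Definition halting s := if act s is Stop _ then true else false.
Definition asking s := if act s is Ask _ _ then true else false.
Definition running s := let: (_, _, _, o, _) := s in ~~ isSome o.

Definition do_halt s : sinstr 8 S :=
  let: (q, c, w, _, m) := s in SJump (q, c, w, if act s is Stop b then Some b else None, m).

Definition do_answer s : sinstr 8 S :=
  let: (q, c, w, o, m) := s in
  SJump (if act s is Ask qno qyes then if answer m then qyes else qno else q, c, w, o, m).

Definition do_query s : sinstr 8 S :=
  if act s is Move _ _ _ (Some b) then SPush (stack 2) b s else SJump s.

Definition do_push (g : sym -> bool) s : sinstr 8 S :=
  match act s with
  | Move _ w DL _ => SPush (stack 1) (g w) s
  | Move _ w DR _ => SPush (stack 0) (g w) s
  | _ => SJump s
  end.

Definition do_pop1 s : sinstr 8 S :=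
  let: (q, c, _, o, m) := s in
  match act s with
  | Move _ _ DL _ => SPop (stack 0) (fun b => (q, c, b, o, m))
  | Move _ _ DR _ => SPop (stack 1) (fun b => (q, c, b, o, m))
  | _ => SJump s
  end.

Definition do_pop2 s : sinstr 8 S :=
  let: (q, c, w, o, m) := s in
  let res b : S := (q, c, if w == Some true then b else None, o, m) in
  match act s with
  | Move _ _ DL _ => SPop (stack 0) res
  | Move _ _ DR _ => SPop (stack 1) res
  | Move _ w' DS _ => SJump (q, c, w', o, m)
  | _ => SJump s
  end.

Definition do_move s : sinstr 8 S :=
  let: (q, c, w, o, m) := s in
  SJump (if act s is Move q' _ _ _ then q' else q, w, w, o, m).

Definition simulate_step : cmd 8 S :=
  If halting (Do do_halt)
    (If asking (R _ ;; Do do_answer)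
       (Do do_query ;; Do (do_push (odflt false)) ;; Do (do_push isSome) ;;
        Do do_pop1 ;; Do do_pop2 ;; Do do_move)).

Definition sim_store (c : config M) (w : sym) (m : RM) inp : store S :=
  Store (cst c, ccur c, w, None, m) inp
    [:: enc_syms (cleft c), enc_syms (cright c), rev (cquery c) & nseq 5 [::]] [::].

Lemma run_simulate_move q l c r y w m inp q' w' d a :
  delta q c = Move q' w' d a ->
  run phi' simulate_step (sim_store (@Config M q l c r y) w m inp) 8
    (fun v => exists w'', v = sim_store
       (let: (l', c', r') := move_tape d l w' r in
        Config q' l' c' r' (y ++ (if a is Some b then [:: b] else [::]))) w'' m inp).
Proof.
move=> E; apply: RunIf; rewrite /halting /= E; apply: RunIf; rewrite /asking /= E.
apply: (@run_seq _ _ _ _ _ _ 1 5); apply: run_do; rewrite /= /do_query /= E.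
case: a E => [b|] E; case: d E => E /=.
all: apply: (@run_seq _ _ _ _ _ _ 1 4); apply: run_do; rewrite /= /do_push /= E /=.
all: apply: (@run_seq _ _ _ _ _ _ 1 3); apply: run_do; rewrite /= /do_push /= E /=.
all: apply: (@run_seq _ _ _ _ _ _ 1 2); apply: run_do; rewrite /= E /=.
all: apply: (@run_seq _ _ _ _ _ _ 1 1); apply: run_do; rewrite /= E /=.
all: apply: run_do; rewrite /= E /= /sim_store.
all: try by (exists w'; rewrite ?cats0 ?cats1 ?rev_rcons).
all: try by (case: l => [|[b'|] l] /=; [exists None|exists (Some b')|exists None];
             rewrite ?cats0 ?cats1 ?rev_rcons).
all: by (case: r => [|[b'|] r] /=; [exists None|exists (Some b')|exists None];
             rewrite ?cats0 ?cats1 ?rev_rcons).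
Qed.

(** A query grows by at most one bit per step, so [N] bounds the length of every query asked and
    [T N] the cost of every call of the subroutine. *)
Lemma run_simulate P t N c w m inp :
  halts_ok phi P t c -> size (cquery c) + t <= N ->
  run phi' (While running simulate_step) (sim_store c w m inp)
    (t * (T N + 20) + 20)
    (fun v => exists2 b, P b & let: (_, _, _, o, _) := mem v in o = Some b).
Proof.
elim: t c w m => [|t IH] [q l c r y] w m.
all: rewrite /=; case E: (delta q c) => [q' w' d a|qno qyes|b] //.
1, 4: move=> Pb _; apply: (@run_le _ _ _ _ _ (2 + 1).+1); last lia.
1, 2: apply: run_loop => //; apply: RunIf; rewrite /halting /= E.
1, 2: apply: RunDo; rewrite /= E; apply: RunDone => //=.
1, 2: by exists b.
- move=> H leN.
  apply: (@run_le _ _ _ _ _ (8 + (t * (T N + 20) + 20)).+1); last by rewrite mulSn; lia.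
  apply: (RunLoop _ (run_simulate_move l r y w m inp E)) => // v [w'' ->].
  move: H; case: (move_tape _ _ _ _) => -[l' c'] r' H; apply: IH H _ => /=.
  by rewrite size_cat; case: (a) => /= *; lia.
- move=> H leN.
  apply: (@run_le _ _ _ _ _ ((T (size y) + 1).+2 + (t * (T N + 20) + 20)).+1).
    apply: run_loop => //; apply: RunIf; rewrite /halting /= E.
    apply: RunIf; rewrite /asking /= E.
    apply: RunSeq (R_solves _ m inp _ _ y) _ => _ [m' /H Hm' ->].
    apply: run_do; rewrite /= E.
    by apply: (IH (Config (if answer m' then qyes else qno) l c r [::]) _ _ Hm'); rewrite /=; lia.
  have : T (size y) <= T N by apply: T_mono; lia.
  by rewrite mulSn; lia.
Qed.

Definition load_step : cmd 8 S :=
  Do (fun s => let: (q, c, _, o, m) := s in SRead (fun b => (q, c, b, o, m))) ;;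
  If (fun s => let: (_, _, w, _, _) := s in isSome w)
    (Do (fun s => let: (_, _, w, _, _) := s in SPush (stack 1) (odflt false w) s) ;;
     Do (fun s => SPush (stack 1) true s))
    (Do (fun s => SJump s)).

(** Loading from the right end leaves the first input symbol on top of stack 1, the right half of
    the simulated tape; the two pops bring it under the head. *)
Definition simulator : cmd 8 S :=
  While (fun s => let: (_, _, w, _, _) := s in isSome w) load_step ;;
  Do (fun s => let: (q, c, _, o, m) := s in SPop (stack 1) (fun b => (q, c, b, o, m))) ;;
  Do (fun s => let: (q, _, w, o, m) := s in SPop (stack 1) (fun b =>
        (q, if w == Some true then b else None, None, o, m))) ;;
  While running simulate_step.

Lemma run_load (q : state M) c m (o : option bool) (b0 : bool) z x l y R' :
  R' (Store (q, c, None, o, m) [::] [:: l, enc_syms (map Some (x ++ z)) & y] [::]) ->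
  run phi' (While (fun s => let: (_, _, w, _, _) := s in isSome w) load_step)
    (Store (q, c, Some b0, o, m) (rev x) [:: l, enc_syms (map Some z) & y] [::])
    (size x * 5 + 5) R'.
Proof.
elim/last_ind: x z b0 => [|x b IH] z b0 HR.
  apply: (@run_loop _ _ _ _ _ _ 3 1) => //.
  apply: (@run_seq _ _ _ _ _ _ 1 2); apply: run_do => /=.
  apply: RunIf; apply: run_do => /=.
  by apply: RunDone.
rewrite size_rcons mulSn -addnA.
apply: (@run_loop _ _ _ _ _ _ 4) => //.
apply: (@run_seq _ _ _ _ _ _ 1 3); apply: run_do; rewrite rev_rcons /=.
apply: RunIf => /=; apply: (@run_seq _ _ _ _ _ _ 1 1); apply: run_do => /=.
by apply: run_do => /=; apply: (IH (b :: z)); rewrite -cat_rcons.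
Qed.

Lemma run_simulator P t x m : x != [::] -> halts_ok phi P t (@init M x) ->
  run phi' simulator
    (Store (start M, None, Some true, None, m) (rev x) (nseq 8 [::]) [::])
    (size x * 5 + t * (T t + 20) + 27)
    (fun v => exists2 b, P b & let: (_, _, _, o, _) := mem v in o = Some b).
Proof.
move=> x0 H.
have -> : size x * 5 + t * (T t + 20) + 27 =
  size x * 5 + 5 + (1 + (1 + (t * (T t + 20) + 20))) by lia.
apply: run_seq; apply: (@run_load _ _ _ _ _ [::]); rewrite cats0.
case: x x0 H => // b x _ H.
apply: run_seq; apply: run_do => /=; apply: run_seq; apply: run_do => /=.
exact: (@run_simulate P t t _ None m [::] H).
Qed.

End Simulator.

(** Queries have various lengths, all at most the running time [peval p n] of the simulated machine;
    monotonicity of [T] gives one cost bound for all of them. *)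
Theorem reduces_solves (RM : finType) (m0 : RM) R answer phi1 phi phi' T :
  @solves RM R answer phi phi' T -> {homo T : m n / m <= n} -> poly_bounded T ->
  reduces phi1 phi -> reduces phi1 phi'.
Proof.
move=> HR mT polyT [M [p HM]].
apply: (@reduces_of_run _ _ (simulator M R answer)
  (start M, None, Some true, None, m0)
  (fun s => let: (_, _, _, o, _) := s in o == Some true) _ _
  (fun n => n * 5 + peval p n * (T (peval p n) + 20) + 27)).
  have polyp := poly_bounded_peval p.
  apply: poly_boundedD; last exact: poly_boundedC.
  apply: poly_boundedD.
    by apply: poly_boundedM; [apply: poly_bounded_id | apply: poly_boundedC].
  apply: poly_boundedM => //; apply: poly_boundedD; last exact: poly_boundedC.
  exact: poly_bounded_comp.
move=> x x0; apply: run_weaken (run_simulator HR mT m0 x0 (HM x x0)) (leqnn _) _.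
by move=> [[[[[q c] w] o] m] ? ? ?] /= [b Pb ->]; case: b Pb.
Qed.

(** * Quantified formulas over infinite blocks *)

Definition env := nat -> nat -> bool.

Definition set_env (r : env) d (x : nat -> bool) : env :=
  fun i j => if i == d then x j else r i j.

(* [Qsat] with blocks ranging over [nat -> bool], so that renaming the bits of a
   block or enlarging it does not change the range of the quantifiers. *)
Fixpoint PQ (ex : bool) (d k : nat) (P : env -> Prop) (r : env) : Prop :=
  if k is k'.+1 then
    if ex then exists x, PQ false d.+1 k' P (set_env r d x)
    else forall x, PQ true d.+1 k' P (set_env r d x)
  else P r.

(** A back-and-forth argument: any move in one game can be answered in the other so that [E]
    persists. The offsets [d] and [d'] differ when one game has more blocks already fixed. *)
Lemma PQ_bisim (E : env -> env -> Prop) P P' k ex d d' r r' :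
  (forall j r r', j < k -> E r r' ->
     (forall x, exists x', E (set_env r (d + j) x) (set_env r' (d' + j) x')) /\
     (forall x', exists x, E (set_env r (d + j) x) (set_env r' (d' + j) x'))) ->
  (forall r r', E r r' -> P r <-> P' r') ->
  E r r' -> PQ ex d k P r <-> PQ ex d' k P' r'.
Proof.
move=> step base; elim: k ex d d' r r' step => [|k IH] ex d d' r r' step Err' /=.
  exact: base.
have step' j s s' : j < k -> E s s' ->
   (forall x, exists x', E (set_env s (d.+1 + j) x) (set_env s' (d'.+1 + j) x')) /\
   (forall x', exists x, E (set_env s (d.+1 + j) x) (set_env s' (d'.+1 + j) x')).
  by move=> ltjk; rewrite !addSnnS; apply: step.
have [fwd bwd] := step 0 r r' isT Err'; rewrite !addn0 in fwd bwd.
case: ex; split.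
- by move=> [x H]; have [x' Exx'] := fwd x; exists x'; apply/(IH _ _ _ _ _ step' Exx').
- by move=> [x' H]; have [x Exx'] := bwd x'; exists x; apply/(IH _ _ _ _ _ step' Exx').
- by move=> H x'; have [x Exx'] := bwd x'; apply/(IH _ _ _ _ _ step' Exx').
- by move=> H x; have [x' Exx'] := fwd x; apply/(IH _ _ _ _ _ step' Exx').
Qed.

Lemma PQ_ext ex d k (P P' : env -> Prop) r :
  (forall s, (forall i j, i < d -> s i j = r i j) -> P s <-> P' s) ->
  PQ ex d k P r <-> PQ ex d k P' r.
Proof.
move=> H; apply: (@PQ_bisim
  (fun s s' => s = s' /\ forall i j, i < d -> s i j = r i j)) => //.
- move=> j s _ _ [<- Hs]; split=> x; exists x; split=> // i l ltid;
    by rewrite /set_env ifN ?Hs //; lia.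
- by move=> s _ [<- Hs]; apply: H.
Qed.

Lemma PQ_const ex d k (Q : Prop) r : PQ ex d k (fun=> Q) r <-> Q.
Proof.
elim: k ex d r => [|k IH] [] d r //=; split.
- by case=> x /IH.
- by move=> q; exists xpred0; apply/IH.
- by move/(_ xpred0)/IH.
- by move=> q x; apply/IH.
Qed.

Lemma PQ_not ex d k P r : PQ ex d k (fun s => ~ P s) r <-> ~ PQ (~~ ex) d k P r.
Proof.
elim: k ex d r => [|k IH] [] d r //=; split.
- by move=> [x /IH H] /(_ x).
- by move=> /not_all_ex_not [x H]; exists x; apply/IH.
- by move=> H [x Hx]; have /IH := H x.
- by move=> H x; apply/IH => Hx; apply: H; exists x.
Qed.

(** An idle last block may be appended. This pads a game that is shorter than the level at which it
    is asked. *)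
Lemma PQ_last ex d k P r :
  (forall s x, P (set_env s (d + k) x) <-> P s) -> PQ ex d k.+1 P r <-> PQ ex d k P r.
Proof.
elim: k ex d r => [|k IH] ex d r H.
  rewrite /= addn0 in H *; case: ex; split.
  - by case=> x /H.
  - by move=> Pr; exists xpred0; apply/H.
  - by move/(_ xpred0)/H.
  - by move=> Pr x; apply/H.
have {}IH ex' s : PQ ex' d.+1 k.+1 P s <-> PQ ex' d.+1 k P s.
  by apply: IH => s' x; rewrite addSnnS.
case: ex; split.
- by move=> [x Hx]; exists x; apply: (proj1 (IH false _)).
- by move=> [x Hx]; exists x; apply: (proj2 (IH false _)).
- by move=> Hx x; apply: (proj1 (IH true _)); apply: Hx.
- by move=> Hx x; apply: (proj2 (IH true _)); apply: Hx.
Qed.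

Lemma eq_eval ms f r r' : vars_ok ms f ->
  (forall i j, i < size ms -> j < nth 0 ms i -> r i j = r' i j) ->
  eval f r = eval f r'.
Proof.
move=> + H; elim: f => [i j|b|g IH|g IHg h IHh|g IHg h IHh] //=.
- by case/andP; apply: H.
- by move/IH ->.
- by case/andP => /IHg -> /IHh ->.
- by case/andP => /IHg -> /IHh ->.
Qed.

Lemma PQ_agree ms f ex d k r r' : vars_ok ms f ->
  (forall i j, i < size ms -> j < nth 0 ms i -> r i j = r' i j) ->
  PQ ex d k (eval f) r <-> PQ ex d k (eval f) r'.
Proof.
move=> okf; apply: (@PQ_bisim (fun r r' => forall i j, i < size ms ->
  j < nth 0 ms i -> r i j = r' i j)) => [j s s' _ Hs|s s' Hs].
  split=> x; exists x => i l lti ltl;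
    by rewrite /set_env; case: eqP => // _; apply: Hs.
by rewrite (eq_eval okf Hs).
Qed.

(** In a block of size [m] the formula reads only the first [m] bits, so an infinite block can be
    truncated to a tuple. *)
Lemma Qsat_PQ ms0 ms f ex r : vars_ok (ms0 ++ ms) f ->
  Qsat ex (size ms0) ms f r <-> PQ ex (size ms0) (size ms) (eval f) r.
Proof.
elim: ms ms0 ex r => [|m ms IH] ms0 ex r okf //=.
have {}IH ex' s :
    Qsat ex' (size ms0).+1 ms f s <-> PQ ex' (size ms0).+1 (size ms) (eval f) s.
  by rewrite -(size_rcons ms0 m); apply: IH; rewrite cat_rcons.
have trunc ex' (x : nat -> bool) :
    PQ ex' (size ms0).+1 (size ms) (eval f) (set_env r (size ms0) x) <->
    PQ ex' (size ms0).+1 (size ms) (eval f)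
      (set_env r (size ms0) (nth false [tuple x i | i < m])).
  apply: PQ_agree okf _ => i j _; rewrite /set_env; case: eqP => // ->.
  rewrite nth_cat ltnn subnn /= => ltjm.
  by have := @nth_mktuple _ _ (fun i : 'I_m => x i) false (Ordinal ltjm).
case: ex; split.
- by move/existsP => [x /IH Hx]; exists (nth false x).
- by move=> [x /trunc Hx]; apply/existsP; exists [tuple x i | i < m]; apply/IH.
- by move/forallP => H x; apply/trunc; apply/IH; apply: H.
- by move=> H; apply/forallP => x; apply/IH; apply: H.
Qed.

(** * Witnesses and the values of the two problems *)

Definition witness m ms f (x : m.-tuple bool) : bool :=
  Qsat false 1 ms f (upd rho0 0 x).

Lemma witness_PQ m ms f (x : m.-tuple bool) : vars_ok (m :: ms) f ->
  witness ms f x <-> PQ false 1 (size ms) (eval f) (set_env rho0 0 (nth false x)).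
Proof. by move=> okf; apply: (@Qsat_PQ [:: m]). Qed.

Lemma UVALval_only m ms f (z0 : m.-tuple bool) :
  (forall z, witness ms f z <-> z = z0) ->
  UVALval (m :: ms) f = Only (nth false z0 0).
Proof.
move=> H; have HW : [pred x : m.-tuple bool | witness ms f x] =i pred1 z0.
  by move=> z; rewrite !inE; apply/idP/eqP => /H.
rewrite /UVALval -/(witness ms f) (eq_card HW) card1 eqxx.
case: pickP => [z Wz|/(_ z0) W0]; first by have /H -> : witness ms f z := Wz.
by have : witness ms f z0 = false := W0; rewrite (proj2 (H z0)).
Qed.

Lemma UVALvalP m ms f :
  (exists z0 : m.-tuple bool, (forall z, witness ms f z <-> z = z0) /\
     UVALval (m :: ms) f = Only (nth false z0 0)) \/ UVALval (m :: ms) f = Both.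
Proof.
have [/card1P [z0 HW]|/negbTE W1] := boolP (#|[pred x | @witness m ms f x]| == 1).
  have H z : witness ms f z <-> z = z0.
    by have := HW z; rewrite !inE => ->; split=> /eqP.
  by left; exists z0; split=> //; apply: UVALval_only.
by right; rewrite /UVALval; have -> := W1.
Qed.

Lemma USATvalP m ms f :
  ((forall z z' : m.-tuple bool, witness ms f z -> witness ms f z' -> z = z') /\
   USATval (m :: ms) f = Only [exists z : m.-tuple bool, witness ms f z]) \/
  ((exists z z' : m.-tuple bool, [/\ witness ms f z, witness ms f z' & z != z']) /\
   USATval (m :: ms) f = Both).
Proof.
rewrite /USATval; case: ifP => W1; [left|right]; split => //.
  by move=> z z' Wz Wz'; apply: (card_le1_eqP W1).
have := negbT W1; rewrite -ltnNge => /card_gt1P [z [z' [Wz Wz' neq]]].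
by exists z, z'.
Qed.

(** * Formula transformations *)

Fixpoint subst (v : nat -> nat -> form) (f : form) : form :=
  match f with
  | FVar i j => v i j
  | FConst b => FConst b
  | FNot g => FNot (subst v g)
  | FAnd g h => FAnd (subst v g) (subst v h)
  | FOr g h => FOr (subst v g) (subst v h)
  end.

Lemma eval_subst v f r : eval (subst v f) r = eval f (fun i j => eval (v i j) r).
Proof. by elim: f => //= [g ->|g -> h ->|g -> h ->]. Qed.

Lemma vars_ok_subst ms ms' v f : vars_ok ms f ->
  (forall i j, i < size ms -> j < nth 0 ms i -> vars_ok ms' (v i j)) ->
  vars_ok ms' (subst v f).
Proof.
move=> + H; elim: f => //= [i j /andP[]|g IHg h IHh /andP[/IHg-> /IHh->]|g IHg h IHh /andP[/IHg-> /IHh->]] //.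
exact: H.
Qed.

(** * Adding one bit in front of every block *)

(** The same shift in all blocks lets one rule rewrite every variable, whatever its block. *)
Definition shift_var i j := FVar i j.+1.
Definition guarded f g := FAnd (subst shift_var f) g.

Definition lead_true := FAnd (FVar 0 0) (FVar 0 1).
Definition lead_eq i :=
  FOr (FAnd (FVar 0 0) (FVar 0 i.+1)) (FAnd (FNot (FVar 0 0)) (FNot (FVar 0 i.+1))).

Lemma vars_ok_guarded m ms f g : vars_ok (m :: ms) f ->
  vars_ok (m.+1 :: map S ms) g -> vars_ok (m.+1 :: map S ms) (guarded f g).
Proof.
move=> okf okg; rewrite /= okg andbT; apply: vars_ok_subst okf _ => i j lti ltj /=.
by case: i lti ltj => [|i] //=; rewrite !ltnS size_map => lti; rewrite (nth_map 0) // lti.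
Qed.

(** Since [g] reads only block 0, its value is settled before the later blocks are played, and it
    can be taken out of the quantifiers. *)
Lemma witness_guarded m ms f g (z : m.+1.-tuple bool) : vars_ok (m :: ms) f ->
  vars_ok (m.+1 :: map S ms) g ->
  (forall r r', r 0 =1 r' 0 -> eval g r = eval g r') ->
  witness (map S ms) (guarded f g) z <->
  witness ms f [tuple of behead z] /\ eval g (set_env rho0 0 (nth false z)).
Proof.
move=> okf okg g0; rewrite !witness_PQ //; last exact: vars_ok_guarded.
rewrite size_map; set r := set_env _ _ (nth _ z).
have -> : PQ false 1 (size ms) (eval (guarded f g)) r <->
          PQ false 1 (size ms) (fun s => eval (subst shift_var f) s /\ eval g r) r.
  apply: PQ_ext => s Hs; rewrite /= (g0 s r) => [|j]; last by rewrite Hs.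
  by split=> [/andP[]|[-> ->]].
have bis : PQ false 1 (size ms) (eval (subst shift_var f)) r <->
    PQ false 1 (size ms) (eval f) (set_env rho0 0 (nth false (behead z))).
  apply: (@PQ_bisim (fun s s' => forall i j, s i j.+1 = s' i j)).
  - move=> d s s' _ Es; split=> x.
      by exists (fun j => x j.+1) => i j; rewrite /set_env; case: eqP.
    by exists (fun j => x j.-1) => i j; rewrite /set_env; case: eqP => //=.
  - move=> s s' Es; rewrite eval_subst /shift_var /=.
    by rewrite (@eq_eval _ f (fun i j => s i j.+1) s' okf).
  - by move=> i j; rewrite /r /set_env nth_behead.
case Eg: (eval g r).
  rewrite -bis; have -> : PQ false 1 (size ms)
      (fun s => eval (subst shift_var f) s /\ true) r <->
      PQ false 1 (size ms) (eval (subst shift_var f)) r.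
    by apply: PQ_ext => s _; split=> [[]|].
  by split=> [|[]].
have -> : PQ false 1 (size ms) (fun s => eval (subst shift_var f) s /\ false) r <->
   PQ false 1 (size ms) (fun=> False) r.
  by apply: PQ_ext => s _; split=> [[]|].
by rewrite PQ_const; split=> [|[]].
Qed.

Lemma UVAL_of_USAT m ms f b : 0 < m -> vars_ok (m :: ms) f ->
  mem_p (USATval (m.+1 :: map S ms) (guarded f lead_true)) b ->
  mem_p (UVALval (m :: ms) f) b.
Proof.
move=> m0 okf; case: (UVALvalP m ms f) => [[x [Hx ->]]|->] //.
have okg : vars_ok (m.+1 :: map S ms) lead_true by rewrite /= !ltnS m0.
have g0 r r' : r 0 =1 r' 0 -> eval lead_true r = eval lead_true r'.
  by move=> E; rewrite /= !E.
have Hz (z : m.+1.-tuple bool) : witness (map S ms) (guarded f lead_true) z <->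
    [tuple of behead z] = x /\ nth false z 0 && nth false z 1.
  by rewrite witness_guarded // Hx /= /set_env.
have Ez (z : m.+1.-tuple bool) : witness (map S ms) (guarded f lead_true) z -> z = [tuple of true :: x].
  move/Hz; case/tupleP: z => c z [<- /andP[/= c1 _]]; apply: val_inj => /=.
  by rewrite c1.
case: (USATvalP m.+1 (map S ms) (guarded f lead_true)) => [[_ ->]|]; last first.
  by case=> -[z [z' [/Ez -> /Ez ->]]]; rewrite eqxx.
move=> /= /eqP ->; apply/eqP; apply/existsP/idP.
  by case=> z Wz; have := Wz; rewrite (Ez z Wz) => /Hz [_] /=.
move=> x0; exists [tuple of true :: x]; apply/Hz; split=> //.
exact: val_inj.
Qed.

Lemma UVAL_bit m ms f (x : m.-tuple bool) i : i < m -> vars_ok (m :: ms) f ->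
  (forall z, witness ms f z <-> z = x) ->
  UVALval (m.+1 :: map S ms) (guarded f (lead_eq i)) = Only (nth false x i).
Proof.
move=> ltim okf Hx.
rewrite (@UVALval_only _ _ _ [tuple of nth false x i :: x]) // => z.
rewrite witness_guarded // => [||r r' E]; last by rewrite /= !E.
  rewrite Hx /= /set_env /=; case/tupleP: z => c z /=.
  split=> [[<- /= H]|].
    apply: val_inj => /=; congr cons.
    by move: H; case: (c) (nth _ z i) => [] [].
  move=> /(congr1 val) /= [-> /val_inj ->]; split; first exact: val_inj.
  by case: (nth _ x i).
by rewrite /= !ltnS ltim.
Qed.

(** * Least counterexamples *)

(** Bit [D - 1] is the most significant. The factor [w || ~~ y] can stand for equality of the top
    bits, because its only other case, [w = 1] and [y = 0], already satisfies the first disjunct. *)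
Fixpoint lex_lt D (y w : nat -> bool) : bool :=
  if D is D'.+1 then
    (w D' && ~~ y D') || ((w D' || ~~ y D') && lex_lt D' y w)
  else false.

Fixpoint number D (w : nat -> bool) : nat :=
  if D is D'.+1 then w D' * 2 ^ D' + number D' w else 0.

Lemma number_lt D w : number D w < 2 ^ D.
Proof.
elim: D => [|D IH] //; rewrite expnS [number _ _]/=; case: (w D); lia.
Qed.

Lemma lex_ltE D y w : lex_lt D y w = (number D y < number D w).
Proof.
elim: D => //= D ->; have := number_lt D y; have := number_lt D w.
by case: (w D); case: (y D); rewrite /= ?mul0n ?mul1n; lia.
Qed.

Lemma number_inj D y w : number D y = number D w -> forall j, j < D -> y j = w j.
Proof.
elim: D => //= D IH E j; rewrite ltnS leq_eqVlt.
have [E1 E2] : y D = w D /\ number D y = number D w.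
  have := number_lt D y; have := number_lt D w; move: E.
  by case: (w D); case: (y D); rewrite /= ?mul0n ?mul1n => *; split=> //; lia.
by case/orP => [/eqP -> //|]; apply: IH.
Qed.

Lemma number_eq D y w : (forall j, j < D -> y j = w j) -> number D y = number D w.
Proof.
elim: D => //= D IH H; rewrite H // IH // => j ltj; apply: H; exact: ltnW.
Qed.

(** The comparison sees only [D] bits, so a descent on [number D w] ends although [w] is an infinite
    sequence. *)
Lemma least_counterexample D (V : (nat -> bool) -> Prop) :
  ~ (forall y, V y) -> exists w, ~ V w /\ forall y, lex_lt D y w -> V y.
Proof.
move=> /not_all_ex_not [w]; move: {2}(number D w) (leqnn (number D w)) => n.
elim: n w => [|n IH] w len Vw.
  by exists w; split=> // y; rewrite lex_ltE; lia.
have [H|/not_all_ex_not [y Hy]] := classic (forall y, lex_lt D y w -> V y).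
  by exists w.
have [/[!lex_ltE] lt_yw Vy] := imply_to_and _ _ Hy.
by apply: IH Vy; lia.
Qed.

(* The bits of [z] are a flag, then alternately the bits of a candidate [a] and
   the bits of a counterexample [w]. *)
Definition search_ok D (a : nat -> bool) (V : (nat -> bool) -> Prop) (z : nat -> bool) :=
  [/\ forall j, j < D -> z j.*2.+1 = a j,
      z 0 -> forall j, j < D -> z j.*2.+2 = false,
      forall y, z 0 || lex_lt D y (fun j => z j.*2.+2) -> V y
    & z 0 \/ ~ V (fun j => z j.*2.+2)].

(** Flag 1 forces [V] to hold everywhere and the counterexample field to vanish; flag 0 forces this
    field to be a counterexample with none below it. Exactly one case occurs, and it determines [z].
    As [z] records only [D] bits, [V] must depend on no others. *)
Lemma search_unique D a V :
  (forall y y', (forall j, j < D -> y j = y' j) -> V y -> V y') ->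
  exists z0 : (D.*2.+1).-tuple bool,
    (nth false z0 0 <-> forall y, V y) /\
    forall z : (D.*2.+1).-tuple bool, search_ok D a V (nth false z) <-> z = z0.
Proof.
move=> extV; pose z0 c w := [tuple
  (if i == 0 :> nat then c else if odd i then a i./2 else w i./2.-1) | i < D.*2.+1].
have z0E c w i : i < D.*2.+1 -> nth false (z0 c w) i =
    if i == 0 then c else if odd i then a i./2 else w i./2.-1.
  by move=> lti; have := @nth_mktuple _ _ _ false (Ordinal lti); apply.
have z00 c w : nth false (z0 c w) 0 = c by rewrite z0E.
have z01 c w j : j < D -> nth false (z0 c w) j.*2.+1 = a j.
  by move=> ltj; rewrite z0E; [rewrite /= odd_double uphalf_double|lia].
have z02 c w j : j < D -> nth false (z0 c w) j.*2.+2 = w j.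
  by move=> ltj; rewrite z0E; [rewrite /= odd_double doubleK|lia].
have z_eq (z z' : (D.*2.+1).-tuple bool) : nth false z 0 = nth false z' 0 ->
   (forall j, j < D -> nth false z j.*2.+1 = nth false z' j.*2.+1) ->
   (forall j, j < D -> nth false z j.*2.+2 = nth false z' j.*2.+2) -> z = z'.
  move=> H0 H1 H2; apply: val_inj; apply: (@eq_from_nth _ false) => [|i].
    by rewrite !size_tuple.
  rewrite size_tuple => lti; case: i lti => // i lti.
  have := odd_double_half i; case: (odd i) => /= Ei.
    by rewrite -Ei; apply: H2; lia.
  by rewrite -Ei; apply: H1; lia.
have [allV|/(least_counterexample D) [w [Vw minw]]] := classic (forall y, V y).
  exists (z0 true xpred0); split; first by rewrite z00.
  move=> z; split=> [[Ha Hw _ []]|->]; last first.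
  - by split=> [j /z01 -> //|_ j /z02 -> //|y _|]; [apply: allV|left; rewrite z00].
  - by move=> /(_ (allV _)).
  - move=> z1; apply: z_eq => [|j ltj|j ltj]; rewrite ?z00 ?z01 ?z02 //; first exact: Ha.
    exact: Hw.
exists (z0 false w); split; first by rewrite z00; split=> // /(_ w).
have Ew c : forall y, number D y = number D w ->
    number D (fun j => nth false (z0 c y) j.*2.+2) = number D w.
  by move=> y <-; apply: number_eq => j /z02.
move=> z; split=> [[Ha Hw Hmin Hc]|->].
  have zF : nth false z 0 = false.
    by apply/negbTE/negP => z1; apply: Vw; apply: Hmin; rewrite z1.
  case: Hc => [|Vz]; first by rewrite zF.
  have En : number D (fun j => nth false z j.*2.+2) = number D w.
    case: (ltngtP (number D (fun j => nth false z j.*2.+2)) (number D w)) => //.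
      by rewrite -lex_ltE => /minw.
    by rewrite -lex_ltE => lt_wz; case: Vw; apply: Hmin; rewrite zF.
  apply: z_eq => [|j ltj|j ltj]; rewrite ?z00 ?z01 ?z02 //; first exact: Ha.
  exact: (number_inj En).
split=> [j /z01 -> //||y|].
- by rewrite z00.
- by rewrite z00 lex_ltE Ew // -lex_ltE; apply: minw.
- right=> H; apply: Vw; apply: extV H => j ltj; exact: z02.
Qed.

(** * The search formula *)

Definition flag := FVar 0 0.
Definition cand j := FVar 0 j.*2.+1.
Definition ctr j := FVar 0 j.*2.+2.

(* [s] lists the candidate's bits from the last one down to bit 0. *)
Fixpoint cand_form (s : seq bool) : form :=
  if s is b :: s' then
    FAnd (if b then cand (size s') else FNot (cand (size s')))
      (FAnd (FOr (FNot flag) (FNot (ctr (size s')))) (cand_form s'))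
  else FConst true.

(* At level 1 there is no second block, and the constant 0 is compared with [ctr]. *)
Definition bit_y n j := if n == 1 then FConst false else FVar 1 j.+1.

Fixpoint lt_form n D : form :=
  if D is D'.+1 then
    FOr (FAnd (ctr D') (FNot (bit_y n D')))
      (FAnd (FOr (ctr D') (FNot (bit_y n D'))) (lt_form n D'))
  else FConst false.

Definition play_var i j := if i is 0 then cand j else FVar i j.+1.

(** With the counterexample stored in block 0, block 2 of [f] is played in block 1, where the
    quantifier is the dual one, as the negation of [f] demands. *)
Definition refute_var i j :=
  match i with 0 => cand j | 1 => ctr j | i'.+2 => FVar i'.+1 j.+1 end.

(** At level 1 nobody chooses: both selectors are false, so both clauses of the search formula have
    to hold. *)
Definition pick_refute n := if n == 1 then FConst false else FVar 1 0.
Definition pick_play n := if n == 1 then FConst false else FNot (FVar 1 0).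

(* The universal player of block 1 chooses, by its bit 0, whether to play [f] on
   the candidate or the negation of [f] on the candidate and the counterexample. *)
Definition search_form n s f :=
  FAnd (cand_form s)
    (FAnd (FOr (pick_refute n) (FOr flag (FNot (subst refute_var f))))
       (FOr (pick_play n)
          (FOr (FNot (FOr flag (lt_form n (size s)))) (subst play_var f)))).

Lemma cand_formP s r : eval (cand_form s) r <->
  (forall j, j < size s -> r 0 j.*2.+1 = nth false (rev s) j) /\
  (r 0 0 -> forall j, j < size s -> r 0 j.*2.+2 = false).
Proof.
elim: s => [|b s IH]; first by split.
have -> : eval (cand_form (b :: s)) r =
  [&& r 0 (size s).*2.+1 == b, r 0 0 ==> ~~ r 0 (size s).*2.+2 & eval (cand_form s) r].
  by rewrite /=; case: b => /=; rewrite ?eqb_id ?eqbF_neg implybE.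
have nths j : j <= size s -> nth false (rev (b :: s)) j =
     if j == size s then b else nth false (rev s) j.
  by move=> lej; rewrite rev_cons nth_rcons size_rev; case: ltngtP lej.
split=> [/and3P[/eqP Hb Hw /IH [H1 H2]]|[H1 H2]].
  split=> [j|r0 j]; rewrite ltnS => lej.
    by rewrite nths //; case: eqP => [-> //|/eqP neq]; apply: H1; rewrite ltn_neqAle neq.
  move: lej; rewrite leq_eqVlt => /orP[/eqP ->|]; last exact: H2.
  by apply/negbTE; move: Hw; rewrite r0.
apply/and3P; split.
- by rewrite H1 //= nths // eqxx.
- by apply/implyP => /H2 ->.
- apply/IH; split=> [j ltj|r0 j ltj]; last by apply: H2; rewrite //= ltnW.
  by rewrite H1 /= ?nths ?ltn_eqF // ltnW.
Qed.

Lemma eval_lt_form n D r : eval (lt_form n D) r =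
  lex_lt D (if n == 1 then xpred0 else fun j => r 1 j.+1) (fun j => r 0 j.*2.+2).
Proof. by elim: D => //= D ->; rewrite /bit_y; case: (n == 1). Qed.

(** All blocks get the size [2D + 1] that block 0 requires, where [D] is the size of [s]; in later
    blocks no index exceeds [D]. *)
Lemma vars_ok_search n ms s f : all (fun m => m <= size s) ms -> size ms = n -> 0 < n ->
  vars_ok ms f -> vars_ok (nseq n (size s).*2.+1) (search_form n s f).
Proof.
move=> lems Ems n0 okf.
have lem i : nth 0 ms i <= size s.
  case: (ltnP i (size ms)) => lti; last by rewrite nth_default.
  by have /allP := lems; apply; rewrite mem_nth.
have : forall i j, i < n -> j < (size s).*2.+1 ->
    vars_ok (nseq n (size s).*2.+1) (FVar i j).
  by move=> i j lti ltj; rewrite /= size_nseq nth_nseq lti.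
move: (nseq _ _) => L okL.
have okc s' : size s' <= size s -> vars_ok L (cand_form s').
  elim: s' => //= b s' IH lts; rewrite IH ?(ltnW lts) // andbT.
  apply/andP; split; last by apply/andP; split; apply: okL => //; lia.
  by case: b; apply: okL => //; lia.
have oky D : D <= size s -> vars_ok L (lt_form n D).
  elim: D => //= D IH ltD; rewrite IH ?(ltnW ltD) // andbT andbb.
  apply/andP; split; first by apply: okL => //; lia.
  by rewrite /bit_y; case: eqP => n1 //; apply: okL; lia.
have okr : vars_ok L (subst refute_var f).
  apply: vars_ok_subst okf _ => i j lti ltj; have := lem i.
  by case: i lti ltj => [|[|i]] lti ltj lei; apply: okL; lia.
have okp : vars_ok L (subst play_var f).
  apply: vars_ok_subst okf _ => i j lti ltj; have := lem i.
  by case: i lti ltj => [|i] lti ltj lei; apply: okL; lia.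
have okf0 : vars_ok L flag by apply: okL.
have okx : vars_ok L (pick_refute n) && vars_ok L (pick_play n).
  by rewrite /pick_refute /pick_play; case: eqP => //= n1; rewrite andbb; apply: okL; lia.
case/andP: okx => ok1 ok2; rewrite /search_form.
have E1 g h : vars_ok L (FAnd g h) = vars_ok L g && vars_ok L h by [].
have E2 g h : vars_ok L (FOr g h) = vars_ok L g && vars_ok L h by [].
have E3 g : vars_ok L (FNot g) = vars_ok L g by [].
by rewrite !(E1, E2, E3) okc // okf0 okr okp oky // ok1 ok2.
Qed.

(** Here [v] is the opponent's first reply to [a]. At level 1 there is no reply and acceptance does
    not depend on [v], which keeps the later statements uniform in the level. *)
Definition accepts (ms : seq nat) f (a v : nat -> bool) : Prop :=
  if ms is _ :: ms' then
    PQ true 2 (size ms') (eval f) (set_env (set_env rho0 0 a) 1 v)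
  else eval f (set_env rho0 0 a).

Lemma witness_accepts m ms f (x : m.-tuple bool) : vars_ok (m :: ms) f ->
  witness ms f x <-> forall v, accepts ms f (nth false x) v.
Proof.
move=> okf; rewrite witness_PQ //; case: ms okf => [|m' ms] okf //=.
by split=> [|/(_ xpred0)].
Qed.

Lemma accepts_agree m ms f a a' v v' : vars_ok (m :: ms) f ->
  (forall j, j < m -> a j = a' j) -> (forall j, j < nth 0 ms 0 -> v j = v' j) ->
  accepts ms f a v <-> accepts ms f a' v'.
Proof.
case: ms => [|m' ms] okf Ha Hv /=.
  rewrite (@eq_eval _ f _ (set_env rho0 0 a') okf) // => i j.
  by rewrite /set_env; case: eqP => // -> _; apply: Ha.
apply: PQ_agree okf _ => i j _; rewrite /set_env.
by case: i => [|[|i]] //=; [apply: Ha | apply: Hv].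
Qed.

Lemma accepts_play ms f (r : env) : vars_ok ms f -> 1 < size ms ->
  (forall i j, 1 < i -> r i j = false) ->
  PQ true 2 (size ms - 2) (eval (subst play_var f)) r <->
  accepts (behead ms) f (fun j => r 0 j.*2.+1) (fun j => r 1 j.+1).
Proof.
case: ms => [|m [|m' ms]] // okf _ r0 /=; rewrite subn2 /=.
apply: (@PQ_bisim (fun s s' => forall i j,
    s' i j = if i is 0 then s 0 j.*2.+1 else s i j.+1)).
- move=> d s s' _ Es; split=> x.
    exists (fun j => x j.+1) => i j; rewrite /set_env /=; case: eqP => [->|_] //.
  exists (fun j => x j.-1) => i j; rewrite /set_env /=; case: eqP => [->|_] //=.
- move=> s s' Es; rewrite eval_subst.
  rewrite (@eq_eval _ f (fun i j => eval (play_var i j) s) s' okf) //.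
  by move=> [|i] j _ _; rewrite Es.
- by move=> [|[|i]] j; rewrite /set_env //= r0.
Qed.

(** Negation dualises the quantifiers, and the existential block 2 of [f] becomes the universal
    block 1. The refutation game thus has one block fewer than the level provides, and an idle last
    block makes up for it. *)
Lemma accepts_refute ms f (r : env) : vars_ok ms f -> 1 < size ms ->
  (forall i j, 1 <= i -> r i j = false) ->
  (forall y, ~~ y 0 ->
     PQ true 2 (size ms - 2) (fun s => ~ eval (subst refute_var f) s) (set_env r 1 y)) <->
  ~ accepts (behead ms) f (fun j => r 0 j.*2.+1) (fun j => r 0 j.*2.+2).
Proof.
case: ms => [|m [|m' ms]] // okf _ r0 /=; rewrite subn2 /=.
set k := size ms; set e := set_env (set_env _ _ _) _ _.
have key y : PQ true 2 k (fun s => ~ eval (subst refute_var f) s) (set_env r 1 y) <->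
    PQ true 3 k (fun s => ~ eval f s) (set_env e 2 (fun j => y j.+1)).
  apply: (@PQ_bisim (fun s s' => forall i j, s' i j =
     match i with 0 => s 0 j.*2.+1 | 1 => s 0 j.*2.+2 | i'.+2 => s i'.+1 j.+1 end)).
  - move=> d s s' _ Es; split=> x.
      exists (fun j => x j.+1) => i j; rewrite /set_env !addSn !add0n.
      by case: i => [|[|i]]; rewrite /= ?Es // ?eqSS; case: eqP.
    exists (fun j => x j.-1) => i j; rewrite /set_env !addSn !add0n.
    by case: i => [|[|i]]; rewrite /= ?Es // ?eqSS; case: eqP.
  - move=> s s' Es; rewrite eval_subst.
    rewrite (@eq_eval _ f (fun i j => eval (refute_var i j) s) s' okf) //.
    by move=> [|[|i]] j _ _; rewrite Es.
  - by move=> [|[|[|i]]] j; rewrite /e /set_env //= r0.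
have -> : ~ PQ true 2 k (eval f) e <-> PQ false 2 k.+1 (fun s => ~ eval f s) e.
  rewrite PQ_last; first by rewrite PQ_not.
  move=> s x; rewrite (@eq_eval _ f (set_env s (2 + k) x) s okf) //.
  by move=> i j lti _; rewrite /set_env ltn_eqF.
split=> [H x|H y _].
  by have := H (fun j => if j is j'.+1 then x j' else false) isT; move/key.
exact/key.
Qed.

Lemma eq_cand_form s r r' : r 0 =1 r' 0 -> eval (cand_form s) r = eval (cand_form s) r'.
Proof. by move=> E; elim: s => //= -[] s -> /=; rewrite !E. Qed.

Lemma eq_lex_lt D y y' w w' : y =1 y' -> w =1 w' -> lex_lt D y w = lex_lt D y' w'.
Proof. by move=> Ey Ew; elim: D => //= D ->; rewrite Ey Ew. Qed.

(** Once block 1 is fixed, its choice bit makes one clause true, and the candidate part and the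
    comparison are constants, so a single game is left under the quantifiers. A conjunction of two
    games could not be split, as [PQ] does not commute with conjunction. *)
Lemma search_form_cases n s f k (r : env) : n != 1 ->
  PQ true 2 k (eval (search_form n s f)) r <->
  eval (cand_form s) r /\
  (if r 1 0 then
     r 0 0 || lex_lt (size s) (fun j => r 1 j.+1) (fun j => r 0 j.*2.+2) ->
     PQ true 2 k (eval (subst play_var f)) r
   else r 0 0 \/ PQ true 2 k (fun t => ~ eval (subst refute_var f) t) r).
Proof.
move=> /negbTE n1; set L := lex_lt _ _ _.
have evalE t : (forall i j, i < 2 -> t i j = r i j) ->
    eval (search_form n s f) t = eval (cand_form s) r &&
      (if r 1 0 then (r 0 0 || L) ==> eval (subst play_var f) t
       else r 0 0 || ~~ eval (subst refute_var f) t).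
  move=> Ht; have Ec : eval (cand_form s) t = eval (cand_form s) r.
    by apply: eq_cand_form => j; rewrite Ht.
  have El : eval (lt_form n (size s)) t = L.
    by rewrite eval_lt_form n1; apply: eq_lex_lt => j; rewrite Ht.
  rewrite /= Ec El /pick_refute /pick_play n1 /= !Ht //.
  by case: (r 1 0); rewrite /= ?andbT ?implybE.
case: (eval (cand_form s) r) evalE => evalE; last first.
  split=> [|[] //]; have -> : PQ true 2 k (eval (search_form n s f)) r <->
      PQ true 2 k (fun=> False) r by apply: PQ_ext => t /evalE ->.
  by rewrite PQ_const.
case: (r 1 0) evalE => evalE.
  case: (r 0 0 || L) evalE => evalE.
    have -> : PQ true 2 k (eval (search_form n s f)) r <->
        PQ true 2 k (eval (subst play_var f)) r by apply: PQ_ext => t /evalE ->.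
    by split=> [H|[_]]; [split|apply].
  have -> : PQ true 2 k (eval (search_form n s f)) r <->
      PQ true 2 k (fun=> True) r by apply: PQ_ext => t /evalE ->.
  by rewrite PQ_const.
case: (r 0 0) evalE => evalE.
  have -> : PQ true 2 k (eval (search_form n s f)) r <->
      PQ true 2 k (fun=> True) r by apply: PQ_ext => t /evalE ->.
  by rewrite PQ_const; split=> // _; split=> //; left.
have -> : PQ true 2 k (eval (search_form n s f)) r <->
    PQ true 2 k (fun t => ~ eval (subst refute_var f) t) r.
  by apply: PQ_ext => t /evalE -> /=; split=> /negP.
by split=> [H|[_ [//|]]]; [split=> //; right|].
Qed.

Lemma witness_search m ms f s (z : (size s).*2.+1.-tuple bool) :
  all (fun m => m <= size s) (m :: ms) -> vars_ok (m :: ms) f ->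
  witness (nseq (size ms) (size s).*2.+1) (search_form (size ms).+1 s f) z <->
  search_ok (size s) (nth false (rev s)) (accepts ms f (nth false (rev s))) (nth false z).
Proof.
move=> lems okf; rewrite witness_PQ; last exact: (@vars_ok_search (size ms).+1 (m :: ms)).
rewrite size_nseq; set zf := nth false z; set r := set_env rho0 0 zf; set D := size s.
have lem : m <= D by case/andP: lems.
set a := nth false (rev s); set xs := fun j => zf j.*2.+1.
have candE : eval (cand_form s) r -> forall v, accepts ms f xs v <-> accepts ms f a v.
  case/cand_formP => Ha _ v; apply: (accepts_agree okf) => // j ltj.
  by apply: Ha; apply: leq_trans lem.
have candP : search_ok D a (accepts ms f a) zf <-> eval (cand_form s) r /\
   ((forall y, zf 0 || lex_lt D y (fun j => zf j.*2.+2) -> accepts ms f xs y) /\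
    (zf 0 \/ ~ accepts ms f xs (fun j => zf j.*2.+2))).
  split=> [[H1 H2 H3 H4]|[Hc [H3 H4]]].
    have Hc : eval (cand_form s) r by apply/cand_formP; split.
    split=> //; split; first by move=> y /H3 /(candE Hc).
    by case: H4; [left|right => /(candE Hc)].
  have [H1 H2] := proj1 (cand_formP _ _) Hc.
  split=> //; first by move=> y /H3 /(candE Hc).
  by case: H4; [left|right => /(candE Hc)].
rewrite {}candP; case: ms lems okf {candE} => [|m' ms] lems okf.
  rewrite /= eval_lt_form /= !eval_subst -/D.
  have Exs v : (forall j, v 0 j = cand j) ->
      eval f (fun i j => eval (v i j) r) = eval f (set_env rho0 0 xs).
    move=> Ev; apply: eq_eval okf _ => -[|i] j // _ _.
    by rewrite Ev.
  rewrite !Exs // -/(zf 0).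
  (* At level 1 acceptance does not depend on [y], so minimality is tested against zero alone:
     something lies below the counterexample only if zero does. *)
  have lt0 y : lex_lt D y (fun j => zf j.*2.+2) ->
     lex_lt D xpred0 (fun j => zf j.*2.+2).
    rewrite !lex_ltE; have -> : number D xpred0 = 0; last lia.
    by elim: (D) => //= d ->.
  have -> : r 0 0 = zf 0 by [].
  split.
    case/and3P => -> H1 H2; split=> //; split=> [y Hy|].
      case/orP: H2 => // /negP []; case/orP: Hy => [->//|/lt0 H].
      by rewrite [lex_lt _ _ _]H orbT.
    by case/orP: H1; [left|right; apply/negP].
  move=> [-> [H1 H2]] /=; apply/andP; split.
    by case: H2 => [->//|/negP ->]; rewrite orbT.
  by rewrite -implybE; apply/implyP => /H1.
have n1 : (size (m' :: ms)).+1 != 1 by [].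
split.
- move=> H; have {}H y := proj1 (@search_form_cases _ s f (size ms) (set_env r 1 y) n1) (H y).
  have Hc : eval (cand_form s) r by have [+ _] := H xpred0; rewrite (@eq_cand_form s _ r).
  split=> //; split=> [y Hy|].
    (* Bit 0 of the reply is set to choose the game on the candidate, and [y] follows it. *)
    have [_ /=] := H (fun j => if j is j'.+1 then y j' else true).
    move=> /(_ Hy) Hp.
    have := proj1 (@accepts_play (m :: m' :: ms) f (set_env r 1 (fun j => if j is j'.+1 then y j' else true)) okf isT _).
    by rewrite /= subn2 /=; apply=> // -[|[|i]].
  case z0: (zf 0); [by left|right].
  apply: (proj1 (@accepts_refute (m :: m' :: ms) f r okf isT _)) => [[|i] //|y y0].
  have [_] := H y; rewrite {1}/set_env /= (negbTE y0) subn2 => -[|//].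
  by rewrite /r /set_env /= z0.
- move=> [Hc [H1 H2]] y; apply/(@search_form_cases _ s f (size ms) (set_env r 1 y) n1).
  split; first by rewrite (@eq_cand_form s _ r).
  rewrite {1}/set_env /=; case y0: (y 0).
    move=> /H1 Hy.
    have := proj2 (@accepts_play (m :: m' :: ms) f (set_env r 1 y) okf isT _).
    by rewrite /= subn2 /=; apply=> // -[|[|i]].
  case: H2 => [|H2]; [by left|right].
  have := proj2 (@accepts_refute (m :: m' :: ms) f r okf isT _) H2 y.
  by rewrite y0 subn2; apply=> // -[].
Qed.

(** The witness is unique for every [s], so the answer is forced even if the bits of [s] came from
    queries outside the promise. *)
Lemma UVAL_search m ms f s :
  all (fun m => m <= size s) (m :: ms) -> vars_ok (m :: ms) f ->
  UVALval (nseq (size ms).+1 (size s).*2.+1) (search_form (size ms).+1 s f) =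
  Only (witness ms f [tuple nth false (rev s) i | i < m]).
Proof.
move=> lems okf; set a := nth false (rev s); set x := [tuple _ | i < m].
have xE v : accepts ms f (nth false x) v <-> accepts ms f a v.
  apply: (accepts_agree okf) => // j ltj.
  by have := @nth_mktuple _ _ (fun i : 'I_m => a i) false (Ordinal ltj).
have [|z0 [z00 Hz]] := @search_unique (size s) a (accepts ms f a).
  move=> y y' E; apply: (proj1 (accepts_agree okf _ _)) => // j ltj; apply: E.
  apply: leq_trans ltj _; case: (ms) lems => //= m' ms'.
  by case/and3P.
rewrite (@UVALval_only _ _ _ z0) => [|z]; last exact: iff_trans (witness_search _ lems okf) (Hz z).
congr Only; apply/idP/idP.
  by move/z00 => H; apply/witness_accepts => // v; apply/xE.
by move/(witness_accepts _ okf) => H; apply/z00 => v; apply/xE.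
Qed.

(** * Encodings *)

Lemma unary_inj i j z z' :
  unary i ++ tSEP ++ z = unary j ++ tSEP ++ z' -> i = j /\ z = z'.
Proof.
elim: i j => [|i IH] [|j] //=; first by case.
by rewrite /unary /= => -[/IH[-> ->]].
Qed.

Lemma enc_var i j :
  enc_form (FVar i j) = tVAR ++ unary i ++ tSEP ++ unary j ++ tSEP.
Proof. by []. Qed.

(** The arbitrary tails express prefix-freeness, the form that the induction through binary
    connectives requires. *)
Lemma enc_form_inj f g z z' :
  enc_form f ++ z = enc_form g ++ z' -> f = g /\ z = z'.
Proof.
have catI (s t t' : seq bool) : s ++ t = s ++ t' -> t = t'.
  by elim: s => //= b s IH [].
elim: f g z z' => [i j|b|f IH|f1 IH1 f2 IH2|f1 IH1 f2 IH2] [i' j'|b'|g|g1 g2|g1 g2] z z';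
  (try by []); (try by case: b); (try by case: b').
- by rewrite !enc_var -!catA => /catI/unary_inj [-> /unary_inj[-> ->]].
- by case: b; case: b' => -[].
- by rewrite -!catA => /(catI tNOT)/IH [-> ->].
- by rewrite -!catA => /(catI tAND)/IH1 [-> /IH2 [-> ->]].
- by rewrite -!catA => /(catI tOR)/IH1 [-> /IH2 [-> ->]].
Qed.

(** A block size is preceded by [tSEP] but not terminated by it, so its end is recognised by a token
    other than [tTICK]. *)
Definition ticks_first z := if z is [:: false, false, false & _] then true else false.

Lemma unary_stop i j z z' : ~~ ticks_first z -> ~~ ticks_first z' ->
  unary i ++ z = unary j ++ z' -> i = j /\ z = z'.
Proof.
move=> Hz Hz'; elim: i j => [|i IH] [|j] //=.
- by move=> E; move: Hz; rewrite E.
- by move=> E; move: Hz'; rewrite -E.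
- by rewrite /unary /= => -[/IH[-> ->]].
Qed.

Lemma ticks_first_form f z : ticks_first (enc_form f ++ z) = false.
Proof. by case: f => // -[]. Qed.

Lemma ticks_first_enc ms f : ticks_first (enc ms f) = false.
Proof. by case: ms => // ; rewrite /enc -[X in ticks_first X]cats0 ticks_first_form. Qed.

Lemma enc_inj ms ms' f f' : enc ms f = enc ms' f' -> ms = ms' /\ f = f'.
Proof.
elim: ms ms' => [|m ms IH] [|m' ms'].
- by rewrite /enc /= -[enc_form f]cats0 -[enc_form f']cats0 => /enc_form_inj [->].
- by case: f => // -[].
- by case: f' {IH} => // -[].
rewrite /enc /= -!catA => -[] /unary_stop [||-> /IH [-> ->]] //.
  by rewrite -/(enc ms f) ticks_first_enc.
by rewrite -/(enc ms' f') ticks_first_enc.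
Qed.

Lemma decode_enc n ms f : valid n ms f -> decode n (enc ms f) = Some (ms, f).
Proof.
move=> ok; rewrite /decode; case: ClassicalEpsilon.excluded_middle_informative => [H|[]]; last first.
  by exists (ms, f).
case: (ClassicalEpsilon.constructive_indefinite_description _ _) => -[ms' f'] /= [_ E].
by have [-> ->] := enc_inj E.
Qed.

Lemma decodeP n y :
  (exists ms f, [/\ valid n ms f, y = enc ms f & decode n y = Some (ms, f)]) \/
  decode n y = None.
Proof.
rewrite /decode; case: ClassicalEpsilon.excluded_middle_informative => [H|]; last by right.
case: (ClassicalEpsilon.constructive_indefinite_description _ _) => -[ms f] /= [ok <-].
by left; exists ms, f.
Qed.

(* Where a tokenizer stands in an instance: [None] in the list of block sizes,
   [Some None] before a connective, [Some (Some (b, k))] inside the block number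
   ([b = false]) or the bit number ([b = true]) of a variable.  There [k] is the
   block number, read so far or in full: [None] for 0, [Some false] for 1, and
   [Some true] for 2 and above. *)
Definition place := option (option (bool * option bool)).

Notation in_form := (Some None : place).
Notation in_block k := (Some (Some (false, k)) : place).
Notation in_bit k := (Some (Some (true, k)) : place).

(** [tTICK] and [tSEP] are the only tokens that begin with two zeros, and their last bit tells them
    apart; hence the tests on [a || b] and on [c] alone. *)
Definition token_next (p : place) (a b c : bool) : place :=
  let formula := if [:: a; b; c] == tVAR then in_block None else in_form in
  match p with
  | None => if a || b then formula else None
  | Some None => formula
  | Some (Some (false, k)) => if c then in_bit k else in_block (Some (isSome k))
  | Some (Some (true, k)) => if c then in_form else in_bit k
  end.

(* The argument of [on_size] and the last argument of [on_block] tell whether the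
   token is [tSEP] rather than [tTICK]; [before_form] precedes the first connective. *)
Record transducer := Transducer {
  on_size : bool -> seq bool;
  before_form : seq bool;
  on_block : option bool -> bool -> seq bool;
  on_bit : option bool -> seq bool }.

Definition token_out (T : transducer) (p : place) (a b c : bool) : seq bool :=
  match p with
  | None => if a || b then before_form T ++ [:: a; b; c] else on_size T c
  | Some None => [:: a; b; c]
  | Some (Some (false, k)) => on_block T k c
  | Some (Some (true, k)) => if c then tSEP else on_bit T k
  end.

(* The second component holds the bits of the current token read so far. *)
Definition reader := (place * option (bool * option bool))%type.

Definition reader_next (st : reader) (c : bool) : reader :=
  match st with
  | (p, None) => (p, Some (c, None))
  | (p, Some (a, None)) => (p, Some (a, Some c))
  | (p, Some (a, Some b)) => (token_next p a b c, None)
  end.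

Definition reader_out (T : transducer) (st : reader) (c : bool) : seq bool :=
  if st is (p, Some (a, Some b)) then token_out T p a b c else [::].

Fixpoint transduce T (st : reader) (y : seq bool) : seq bool :=
  if y is b :: y' then reader_out T st b ++ transduce T (reader_next st b) y'
  else [::].

Lemma transduce_token T p a b c z :
  transduce T (p, None) [:: a, b, c & z] =
  token_out T p a b c ++ transduce T (token_next p a b c, None) z.
Proof. by []. Qed.

Lemma unaryS k : unary k.+1 = tTICK ++ unary k. Proof. by []. Qed.

Lemma transduce_bit T k j z :
  transduce T (in_bit k, None) (unary j ++ tSEP ++ z) =
  flatten (nseq j (on_bit T k)) ++ tSEP ++ transduce T (in_form, None) z.
Proof. by elim: j => [|j IH] //; rewrite unaryS -catA transduce_token IH /= catA. Qed.

Lemma transduce_block2 T i z :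
  transduce T (in_block (Some true), None) (unary i ++ tSEP ++ z) =
  flatten (nseq i (on_block T (Some true) false)) ++ on_block T (Some true) true ++
  transduce T (in_bit (Some true), None) z.
Proof. by elim: i => [|i IH] //; rewrite unaryS -catA transduce_token IH /= catA. Qed.

Definition renames T (v : nat -> nat -> form) := forall i j z,
  transduce T (in_form, None) (enc_form (FVar i j) ++ z) =
  enc_form (v i j) ++ transduce T (in_form, None) z.

Lemma transduce_form T v f z : renames T v ->
  transduce T (in_form, None) (enc_form f ++ z) =
  enc_form (subst v f) ++ transduce T (in_form, None) z.
Proof.
move=> Tv; elim: f z => [i j|b|f IH|f IHf g IHg|f IHf g IHg] z.
- exact: Tv.
- by case: b.
- by rewrite /= -IH.
- by rewrite /= -!catA -IHg -IHf.
- by rewrite /= -!catA -IHg -IHf.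
Qed.

Lemma transduce_enc T v ms f : renames T v ->
  transduce T (None, None) (enc ms f) =
  flatten [seq on_size T true ++ flatten (nseq m (on_size T false)) | m <- ms] ++
  before_form T ++ enc_form (subst v f).
Proof.
move=> Tv; have Hf z : transduce T (None, None) (enc_form f ++ z) =
    before_form T ++ transduce T (in_form, None) (enc_form f ++ z).
  by case: f => [i j|[]|g|g h|g h]; rewrite /= -catA.
rewrite /enc; elim: ms => [|m ms IH] /=.
  by rewrite -[enc_form f]cats0 Hf (transduce_form _ _ Tv) /= !cats0.
rewrite -!catA -IH; congr (_ ++ _).
by elim: m => [|m IHm] //; rewrite unaryS -catA transduce_token IHm /= catA.
Qed.

(** The tick inserted after [tSEP] adds one to a block size or to a bit number. [tAND] opens the
    conjunction whose right operand [guarded_query] appends. *)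
Definition shift_tr := Transducer
  (fun sep => if sep then tSEP ++ tTICK else tTICK) tAND
  (fun _ sep => if sep then tSEP ++ tTICK else tTICK) (fun _ => tTICK).

Definition play_tr := Transducer (fun _ => [::]) [::]
  (fun _ sep => if sep then tSEP ++ tTICK else tTICK)
  (fun k => if k is None then tTICK ++ tTICK else tTICK).

(** Dropping the first tick of a block number lowers the block by one. In blocks 0 and 1 the ticks
    of the bit number are doubled, after an offset of 1 or 2 that separates [cand] from [ctr]. *)
Definition refute_tr := Transducer (fun _ => [::]) [::]
  (fun k sep =>
     if sep then tSEP ++ (if k is Some false then tTICK ++ tTICK else tTICK)
     else if k is None then [::] else tTICK)
  (fun k => if k is Some true then tTICK else tTICK ++ tTICK).

Lemma flatten_ticks2 j : flatten (nseq j (tTICK ++ tTICK)) = unary j.*2.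
Proof. by elim: j => // j; rewrite doubleS !unaryS /= => ->. Qed.

Lemma shift_tr_renames : renames shift_tr shift_var.
Proof.
move=> i j z; rewrite enc_var -!catA.
by case: i => [|[|i]];
  rewrite ?unaryS -?catA !transduce_token /= ?transduce_block2 transduce_bit.
Qed.

Lemma play_tr_renames : renames play_tr play_var.
Proof.
move=> i j z; rewrite enc_var -!catA.
case: i => [|[|i]]; rewrite ?unaryS -?catA !transduce_token /= ?transduce_block2 transduce_bit //=.
by rewrite flatten_ticks2.
Qed.

Lemma refute_tr_renames : renames refute_tr refute_var.
Proof.
move=> i j z; rewrite enc_var -!catA.
case: i => [|[|i]]; rewrite ?unaryS -?catA !transduce_token /= ?transduce_block2 transduce_bit //=.
- by rewrite flatten_ticks2.
- by rewrite flatten_ticks2.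
Qed.

(** * The oracle queries as strings *)

Definition guarded_query g y := transduce shift_tr (None, None) y ++ enc_form g.

Lemma guarded_queryE g ms f :
  guarded_query g (enc ms f) = enc (map S ms) (guarded f g).
Proof.
rewrite /guarded_query (transduce_enc _ _ shift_tr_renames) /enc -map_comp /= -!catA.
by congr (flatten _ ++ _).
Qed.

Definition search_query n s y :=
  flatten (nseq n (tSEP ++ unary (size s).*2.+1)) ++
  tAND ++ enc_form (cand_form s) ++
  tAND ++ tOR ++ enc_form (pick_refute n) ++ tOR ++ enc_form flag ++
  tNOT ++ transduce refute_tr (None, None) y ++
  tOR ++ enc_form (pick_play n) ++ tOR ++ tNOT ++ tOR ++ enc_form flag ++
  enc_form (lt_form n (size s)) ++ transduce play_tr (None, None) y.

Lemma search_queryE n s ms f :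
  search_query n s (enc ms f) = enc (nseq n (size s).*2.+1) (search_form n s f).
Proof.
have drop_sizes : flatten [seq [::] ++ flatten (nseq m [::]) | m <- ms] = [::] :> seq bool.
  by elim: ms => //= m ms ->; rewrite cats0; elim: m.
rewrite /search_query (transduce_enc _ _ refute_tr_renames).
rewrite (transduce_enc _ _ play_tr_renames) /= !drop_sizes /enc map_nseq.
by rewrite /search_form /= -!catA.
Qed.

Lemma valid_guarded n m ms f g : valid n (m :: ms) f ->
  vars_ok (m.+1 :: map S ms) g -> valid n (map S (m :: ms)) (guarded f g).
Proof.
case/andP=> /andP[/eqP En _] okf okg; rewrite /valid size_map En eqxx.
by rewrite vars_ok_guarded // andbT all_map; apply/allP.
Qed.

Lemma UVAL_of_USAT_query n y b : 0 < n ->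
  mem_p (USAT n (guarded_query lead_true y)) b -> mem_p (UVAL n y) b.
Proof.
move=> n0; rewrite /USAT /UVAL; case: (decodeP n y) => [|-> //].
case=> ms [f [ok -> ->]]; case/andP: (ok) => /andP[/eqP En posms] okf.
case: ms posms okf En ok => [|m ms] posms okf En ok; first by move: n0; rewrite -En.
have /andP[m0 _] := posms.
rewrite guarded_queryE decode_enc; first exact: UVAL_of_USAT.
by apply: valid_guarded; rewrite //= !ltnS m0.
Qed.

Lemma unary_size k : size (unary k) = k * 3.
Proof. by elim: k => // k IH; rewrite unaryS size_cat IH. Qed.

(** Sizes are written in unary, so the length of an instance bounds each of them and can serve as
    the number of candidate bits. *)
Lemma enc_size ms f : all (fun m => m <= size (enc ms f)) ms.
Proof.
apply/allP => m; elim: ms => // m' ms IH.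
have -> : enc (m' :: ms) f = tSEP ++ unary m' ++ enc ms f by rewrite /enc /= -catA.
rewrite !size_cat unary_size inE => /orP[/eqP ->|/IH le_m].
  by rewrite addnCA (leq_trans _ (leq_addr _ _)) // leq_pmulr.
by apply: leq_trans le_m _; rewrite size_cat addnA leq_addl.
Qed.

(** A positive test exhibits a witness whatever the bits are. Conversely, inside the promise an
    existing witness is unique, so the bit queries with [i < m] spell it out; the bits from [m] on
    lie outside the block. *)
Lemma USAT_of_UVAL_query n y s b : 0 < n -> size s = size y ->
  (forall i, i < size y ->
     mem_p (UVAL n (guarded_query (lead_eq i) y)) (nth false (rev s) i)) ->
  mem_p (UVAL n (search_query n s y)) b -> mem_p (USAT n y) b.
Proof.
move=> n0 Es; rewrite /USAT; case: (decodeP n y) => [|-> //].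
case=> ms [f [ok Ey ->]]; case/andP: (ok) => /andP[/eqP En posms] okf.
case: ms posms okf En ok Ey => [|m ms] posms okf En ok Ey; first by move: n0; rewrite -En.
have lems : all (fun m => m <= size s) (m :: ms) by rewrite Es Ey enc_size.
have lem : m <= size y by rewrite -Es; case/andP: lems.
move=> Hbits; rewrite Ey search_queryE /UVAL decode_enc; last first.
  rewrite /valid size_nseq eqxx all_nseq orbT /=.
  exact: (@vars_ok_search _ (m :: ms)).
rewrite -{1 2}En (UVAL_search lems okf) [mem_p (Only _) _]/= => /eqP ->.
case: (USATvalP m ms f) => [[uniq_w ->]|[_ ->] //] /=; apply/eqP.
apply/idP/existsP => [Wx|[x Wx]]; first by exists [tuple nth false (rev s) i | i < m].
suff -> : [tuple nth false (rev s) i | i < m] = x by [].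
apply: eq_from_tnth => i; rewrite tnth_mktuple.
have Hx z : witness ms f z <-> z = x by split=> [Wz|-> //]; apply: uniq_w.
have := Hbits i (leq_trans (ltn_ord i) lem).
rewrite Ey guarded_queryE /UVAL decode_enc; last first.
  by apply: valid_guarded; rewrite //= !ltnS ltn_ord.
by rewrite (UVAL_bit (ltn_ord i) okf Hx) /= (tnth_nth false) => /eqP.
Qed.

(** * The two programs *)

(* the bit last popped, the state of the tokenizer, the last oracle answer *)
Notation regs := (option bool * reader * bool)%type.

Section Programs.

Variables (X : finType) (x : X) (inp : seq bool) (phi : promise).

Notation S := (X * regs)%type.

(* Stacks 0 and 1 belong to the caller; stack 2 holds the argument and stack 3 its
   copy with the first bit on top; 4 is a scratch stack, 5 and 6 are counters in
   unary, and 7 collects the bits of the candidate. *)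

Definition popped (s : S) := let: (_, (o, _, _)) := s in o.
Definition set_popped (s : S) o : S := let: (x, (_, rd, ans)) := s in (x, (o, rd, ans)).
Definition bit s := odflt false (popped s).

Definition skip : cmd 8 S := Do (fun s => SJump s).
Definition push i b : cmd 8 S := Do (fun s => SPush i b s).
Definition put i : cmd 8 S := Do (fun s => SPush i (bit s) s).

(** The word may depend on the memory; words shorter than [k] are padded with idle steps, so the
    running time depends on [k] alone. *)
Fixpoint emit_by k (g : S -> seq bool) : cmd 8 S :=
  if k is k'.+1 then
    emit_by k' g ;;
    Do (fun s => if k' < size (g s) then SEmit (nth false (g s) k') s else SJump s)
  else skip.

Arguments emit_by : simpl never.

Definition emit w := emit_by (size w) (fun=> w).

(** The popped bit doubles as the loop test. It is reset after the body, which may itself contain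
    drains. *)
Definition drain i (body : cmd 8 S) : cmd 8 S :=
  Do (fun s => SJump (set_popped s (Some true))) ;;
  While (fun s => isSome (popped s))
    (Do (fun s => SPop i (set_popped s)) ;;
     If (fun s => isSome (popped s))
       (body ;; Do (fun s => SJump (set_popped s (Some true)))) skip).

Lemma run_emit_by k g m i stk y R :
  R (Store m i stk (y ++ take k (g m))) -> run phi (emit_by k g) (Store m i stk y) k.+1 R.
Proof.
elim: k R => [|k IH] R HR; first by rewrite take0 cats0 in HR; apply: run_do.
rewrite -[k.+2]addn1; apply: run_seq; apply: IH; apply: run_do => /=.
case: ltnP => le_k; move: HR; first by rewrite (take_nth false) // -rcons_cat.
by rewrite !take_oversize // ltnW.
Qed.

Lemma run_emit w m i stk y R :
  R (Store m i stk (y ++ w)) -> run phi (emit w) (Store m i stk y) (size w).+1 R.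
Proof. by move=> HR; apply: run_emit_by; rewrite take_size. Qed.

Definition after_pop (u : store S) i o z :=
  Store (set_popped (mem u) o) (input u) (set_nth [::] (stacks u) i z) (query u).

Lemma run_drain (i : 'I_8) body (I : seq bool -> store S -> Prop) c z u R :
  (forall z u o, I z u -> I z (Store (set_popped (mem u) o) (input u) (stacks u) (query u))) ->
  (forall b z u, I (b :: z) u -> nth [::] (stacks u) i = b :: z /\
     run phi body (after_pop u i (Some b) z) c (I z)) ->
  (forall u, I [::] u -> nth [::] (stacks u) i = [::] /\ R (after_pop u i None [::])) ->
  I z u -> run phi (drain i body) u (size z * (c + 4) + 6) R.
Proof.
move=> Iset Istep Iend Iz.
have -> : size z * (c + 4) + 6 = 1 + (size z * (c + 4) + 5) by lia.
apply: run_seq; apply: run_do.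
case: u Iz => -[x' [[o rd] ans]] inp' stk y Iz /=.
move: (Iset _ _ (Some true) Iz) => {Iz} /=.
elim: z x' rd ans inp' stk y => [|b z IH] x' rd ans inp' stk y Iz.
  have [E HR] := Iend _ Iz; apply: (@run_loop _ _ _ _ _ _ 3 1) => //.
  apply: (@run_seq _ _ _ _ _ _ 1 2); apply: run_do; rewrite /= E.
  by apply: RunIf; apply: run_do; apply: RunDone.
have [E Hb] := Istep _ _ _ Iz; rewrite /= in E.
apply: (@run_le _ _ _ _ _ ((1 + (c + 1).+1) + (size z * (c + 4) + 5)).+1); last by rewrite /=; lia.
apply: run_loop => //; apply: run_seq; apply: run_do; rewrite /= E.
apply: RunIf => /=; apply: run_seq.
apply: run_weaken Hb (leqnn _) _ => -[[x'' [[o' rd'] ans']] inp'' stk' y'] Iz'.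
by apply: run_do => /=; apply: IH; apply: (Iset _ _ (Some true) Iz').
Qed.

Notation St o rd ans l r q y t d u a w :=
  (Store (x, (o, rd, ans)) inp [:: l; r; q; y; t; d; u; a] w).

Section Straight.
Variables (l r : seq bool).

(** Reading a unary counter consumes it, so it is moved to the scratch stack, and [untally] moves it
    back; either trip emits [w] once per unit. *)
Definition tally w := drain (stack 6) (emit w ;; push (stack 4) true).
Definition untally w := drain (stack 4) (emit w ;; push (stack 6) true).

Lemma run_tally w k o rd ans q y d a out R :
  R (St None rd ans l r q y (nseq k true) d [::] a (out ++ flatten (nseq k w))) ->
  run phi (tally w) (St o rd ans l r q y [::] d (nseq k true) a out)
    (k * (size w + 6) + 6) R.
Proof.
move=> HR; have -> : k * (size w + 6) + 6 = size (nseq k true) * ((size w).+1 + 1 + 4) + 6.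
  by rewrite size_nseq; lia.
apply: (@run_drain _ _ (fun z v => exists o t out',
   [/\ v = St o rd ans l r q y (nseq t true) d z a out', t + size z = k
     & out' ++ flatten (nseq (size z) w) = out ++ flatten (nseq k w)])).
- by move=> z _ o' [? [t [out' [-> Et Eo]]]]; exists o', t, out'.
- move=> b z _ [o' [t [out' [-> Et Eo]]]]; split=> //.
  apply: run_seq; apply: run_emit; apply: run_do => /=.
  exists (Some b), t.+1, (out' ++ w); split=> //; first by rewrite -Et /= addnS.
  by rewrite -Eo /= catA.
- move=> _ [o' [t [out' [-> Et Eo]]]]; split=> //=.
  by move: HR; rewrite -Eo -Et /= cats0 addn0.
- by exists o, 0, out; rewrite size_nseq.
Qed.

Lemma run_untally w k o rd ans q y d a out R :
  R (St None rd ans l r q y [::] d (nseq k true) a (out ++ flatten (nseq k w))) ->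
  run phi (untally w) (St o rd ans l r q y (nseq k true) d [::] a out)
    (k * (size w + 6) + 6) R.
Proof.
move=> HR; have -> : k * (size w + 6) + 6 = size (nseq k true) * ((size w).+1 + 1 + 4) + 6.
  by rewrite size_nseq; lia.
apply: (@run_drain _ _ (fun z v => exists o t out',
   [/\ v = St o rd ans l r q y z d (nseq t true) a out', t + size z = k
     & out' ++ flatten (nseq (size z) w) = out ++ flatten (nseq k w)])).
- by move=> z _ o' [? [t [out' [-> Et Eo]]]]; exists o', t, out'.
- move=> b z _ [o' [t [out' [-> Et Eo]]]]; split=> //.
  apply: run_seq; apply: run_emit; apply: run_do => /=.
  exists (Some b), t.+1, (out' ++ w); split=> //; first by rewrite -Et /= addnS.
  by rewrite -Eo /= catA.
- move=> _ [o' [t [out' [-> Et Eo]]]]; split=> //=.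
  by move: HR; rewrite -Eo -Et /= cats0 addn0.
- by exists o, 0, out; rewrite size_nseq.
Qed.

Definition load := drain (stack 2) (put (stack 3) ;; push (stack 5) true).

Lemma run_load_query y o rd ans R :
  R (St None rd ans l r [::] y [::] (nseq (size y) true) [::] [::] [::]) ->
  run phi load (St o rd ans l r (rev y) [::] [::] [::] [::] [::] [::]) (size y * 6 + 6) R.
Proof.
move=> HR; rewrite -(size_rev y).
apply: (@run_drain _ _ (fun z v => exists o y', rev z ++ y' = y /\
   v = St o rd ans l r z y' [::] (nseq (size y') true) [::] [::] [::]) 2).
- by move=> z _ o' [? [y' [E ->]]]; exists o', y'.
- move=> b z _ [o' [y' [E ->]]]; split=> //.
  apply: (@run_seq _ _ _ _ _ _ 1 1); apply: run_do => /=; apply: run_do => /=.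
  by exists (Some b), (b :: y'); split=> //; rewrite -E rev_cons cat_rcons.
- by move=> _ [o' [y' [/= -> ->]]].
- by exists o, [::]; rewrite revK cats0.
Qed.

Definition clear i := drain i skip.

Lemma run_clear3 y o rd ans q t d u a out R :
  R (St None rd ans l r q [::] t d u a out) ->
  run phi (clear (stack 3)) (St o rd ans l r q y t d u a out) (size y * 5 + 6) R.
Proof.
move=> HR; apply: (@run_drain _ _ (fun z v => exists o,
   v = St o rd ans l r q z t d u a out) 1).
- by move=> z _ o' [? ->]; exists o'.
- by move=> b z _ [o' ->]; split=> //; apply: run_do; exists (Some b).
- by move=> _ [o' ->].
- by exists o.
Qed.

Lemma run_clear5 d o rd ans q y t u a out R :
  R (St None rd ans l r q y t [::] u a out) ->
  run phi (clear (stack 5)) (St o rd ans l r q y t d u a out) (size d * 5 + 6) R.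
Proof.
move=> HR; apply: (@run_drain _ _ (fun z v => exists o,
   v = St o rd ans l r q y t z u a out) 1).
- by move=> z _ o' [? ->]; exists o'.
- by move=> b z _ [o' ->]; split=> //; apply: run_do; exists (Some b).
- by move=> _ [o' ->].
- by exists o.
Qed.

Definition start_reader : cmd 8 S :=
  Do (fun s => let: (x, (o, _, ans)) := s in SJump (x, (o, (None, None), ans))).

Definition advance : cmd 8 S :=
  Do (fun s => let: (x, (o, rd, ans)) := s in
               SJump (x, (o, reader_next rd (odflt false o), ans))).

Definition transducing T :=
  start_reader ;;
  drain (stack 3) (put (stack 4) ;;
    (* The longest output at one input bit is three tokens: [refute_tr] emits [tSEP] and two ticks
       after block number 1. *)
    emit_by 9 (fun s => let: (_, (o, rd, _)) := s in reader_out T rd (odflt false o)) ;;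
    advance) ;;
  drain (stack 4) (put (stack 3)).

Lemma run_transducing T o rd ans q y d u a out R :
  (forall rd b, size (reader_out T rd b) <= 9) ->
  (forall rd', R (St None rd' ans l r q y [::] d u a
     (out ++ transduce T (None, None) y))) ->
  run phi (transducing T) (St o rd ans l r q y [::] d u a out) (size y * 21 + 13) R.
Proof.
move=> small HR; have -> : size y * 21 + 13 =
  1 + ((size y * (12 + 4) + 6) + (size y * (1 + 4) + 6)) by lia.
apply: run_seq; apply: run_do => /=; apply: run_seq.
apply: (@run_drain _ _ (fun z v => exists o rd t out',
   [/\ v = St o rd ans l r q z t d u a out', rev t ++ z = y
     & out' ++ transduce T rd z = out ++ transduce T (None, None) y])).
- by move=> z _ o' [? [rd' [t [out' [-> Et Eo]]]]]; exists o', rd', t, out'.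
- move=> b z _ [o' [rd' [t [out' [-> Et Eo]]]]]; split=> //.
  apply: (@run_seq _ _ _ _ _ _ 1 11); apply: run_do => /=.
  apply: (@run_seq _ _ _ _ _ _ 10 1); apply: run_emit_by; apply: run_do.
  rewrite take_oversize; last exact: small.
  exists (Some b), (reader_next rd' b), (b :: t), (out' ++ reader_out T rd' b).
  by split=> //; rewrite ?rev_cons ?cat_rcons // -Eo /= catA.
- move=> _ [o' [rd' [t [out' [-> Et Eo]]]]]; split=> //=.
  have -> : size y = size t by rewrite -Et cats0 size_rev.
  apply: (@run_drain _ _ (fun z v => exists o y',
    rev z ++ y' = y /\ v = St o rd' ans l r q y' z d u a out')).
  + by move=> z _ o'' [? [y' [E ->]]]; exists o'', y'.
  + move=> b z _ [o'' [y' [E ->]]]; split=> //; apply: run_do => /=.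
    by exists (Some b), (b :: y'); split=> //; rewrite -E rev_cons cat_rcons.
  + move=> _ [o'' [y' [/= E ->]]]; split=> //=.
    by move: (HR rd'); rewrite -Eo /= cats0 E.
  + by exists None, [::]; rewrite -Et.
- by exists o, (None, None), [::], out.
Qed.

Definition ask : cmd 8 S :=
  Do (fun s => let: (x, (o, rd, _)) := s in SAsk (fun ans => (x, (o, rd, ans)))).

Definition uval_solver :=
  load ;; transducing shift_tr ;; emit (enc_form lead_true) ;; ask ;;
  clear (stack 3) ;; clear (stack 5).

Lemma shift_tr_small rd b : size (reader_out shift_tr rd b) <= 9.
Proof. by case: rd b => -[[[[] k]|]|] [[[] [[]|]]|] []. Qed.

Lemma play_tr_small rd b : size (reader_out play_tr rd b) <= 9.
Proof. by case: rd b => -[[[[] [k|]]|]|] [[[] [[]|]]|] []. Qed.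

Lemma refute_tr_small rd b : size (reader_out refute_tr rd b) <= 9.
Proof. by case: rd b => -[[[[] [[]|]]|]|] [[[] [[]|]]|] []. Qed.

Lemma run_uval_solver o rd ans y R :
  (forall o' rd' b, mem_p (phi (guarded_query lead_true y)) b ->
     R (St o' rd' b l r [::] [::] [::] [::] [::] [::] [::])) ->
  run phi uval_solver (St o rd ans l r (rev y) [::] [::] [::] [::] [::] [::])
    (100 * (size y).+1) R.
Proof.
(* The time is left open here: the lemmas on [run] assemble it, and the final arithmetic compares it
   with the stated bound. *)
move=> HR; eapply run_le.
  eapply run_seq; eapply run_load_query.
  eapply run_seq; eapply run_transducing; first exact: shift_tr_small.
  move=> rd'; eapply run_seq; eapply run_emit.
  eapply run_seq; eapply run_do => /= b Hb.
  eapply run_seq; eapply run_clear3; eapply run_clear5.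
  exact: HR Hb.
by rewrite size_nseq /=; lia.
Qed.

(** [lead_eq i] mentions bit [i] twice: [tally] writes the first occurrence and moves the counter
    away, [untally] writes the second and restores it. *)
Definition query_bit :=
  transducing shift_tr ;;
  emit (tOR ++ tAND ++ enc_form flag ++ tVAR ++ tSEP ++ tTICK) ;; tally tTICK ;;
  emit (tSEP ++ tAND ++ tNOT ++ enc_form flag ++ tNOT ++ tVAR ++ tSEP ++ tTICK) ;;
  untally tTICK ;; emit tSEP ;; ask ;; Do (fun s => SPush (stack 7) s.2.2 s).

Lemma run_query_bit i o rd ans q y d a R :
  (forall rd' b, mem_p (phi (guarded_query (lead_eq i) y)) b ->
     R (St None rd' b l r q y [::] d (nseq i true) (b :: a) [::])) ->
  run phi query_bit (St o rd ans l r q y [::] d (nseq i true) a [::])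
    (size y * 21 + i * 18 + 150) R.
Proof.
move=> HR; eapply run_le.
  eapply run_seq; eapply run_transducing; first exact: shift_tr_small.
  move=> rd'; eapply run_seq; eapply run_emit.
  eapply run_seq; eapply run_tally; eapply run_seq; eapply run_emit.
  eapply run_seq; eapply run_untally; eapply run_seq; eapply run_emit.
  eapply run_seq; eapply run_do => /= b Hb; eapply run_do => /=.
  apply: HR; congr (mem_p (phi _) b): Hb.
  by rewrite /guarded_query -!catA /= -catA.
by rewrite /=; lia.
Qed.

(** Stack 6 counts the bits found, which is also the index of the next one. The bits pile up with
    the last on top, the order in which [cand_form] takes them. *)
Definition bits_loop := drain (stack 5) (query_bit ;; push (stack 6) true).

Lemma run_bits_loop k o rd ans q y R :
  (forall rd' ans' a, size a = k ->
     (forall i, i < k -> mem_p (phi (guarded_query (lead_eq i) y)) (nth false (rev a) i)) ->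
     R (St None rd' ans' l r q y [::] [::] (nseq k true) a [::])) ->
  run phi bits_loop (St o rd ans l r q y [::] (nseq k true) [::] [::] [::])
    (k * (size y * 21 + k * 18 + 155) + 6) R.
Proof.
move=> HR; apply: (@run_le _ _ _ _ _
    (size (nseq k true) * ((size y * 21 + k * 18 + 150) + 1 + 4) + 6));
  last by rewrite size_nseq; lia.
apply: (@run_drain _ _ (fun z v => exists o rd ans a,
   [/\ v = St o rd ans l r q y [::] z (nseq (size a) true) a [::], size a + size z = k
     & forall i, i < size a ->
         mem_p (phi (guarded_query (lead_eq i) y)) (nth false (rev a) i)])).
- by move=> z _ o' [? [rd' [ans' [a [-> Ek Ha]]]]]; exists o', rd', ans', a.
- move=> b z _ [o' [rd' [ans' [a [-> Ek Ha]]]]]; split=> //.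
  apply: run_seq; apply: (@run_le _ _ _ _ _ (size y * 21 + size a * 18 + 150)).
    apply: run_query_bit => rd'' b' Hb'; apply: run_do => /=.
    exists None, rd'', b', (b' :: a); split=> //=; first by rewrite -Ek /=; lia.
    move=> i; rewrite ltnS rev_cons nth_rcons size_rev => le_i.
    by case: ltngtP le_i => [lt_i _|//|-> _ //]; apply: Ha.
  by rewrite /= in Ek *; lia.
- move=> _ [o' [rd' [ans' [a [-> Ek Ha]]]]]; split=> //=.
  by move: Ek; rewrite addn0 => Ek; rewrite Ek; apply: HR => // i; rewrite -Ek; apply: Ha.
- by exists o, rd, ans, [::]; split=> //; rewrite size_nseq.
Qed.

Lemma unary_double k : unary k ++ unary k = unary k.*2.
Proof. by rewrite /unary -flatten_cat -nseqD addnn. Qed.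

(** The two trips of the counter write [2k] ticks; [pre] supplies block 0 and the offset 1 for
    [cand] or 2 for [ctr]. *)
Definition emit_var pre := emit (tVAR ++ pre) ;; tally tTICK ;; untally tTICK ;; emit tSEP.

Lemma run_emit_var pre k o rd ans q y d a out R :
  (R (St None rd ans l r q y [::] d (nseq k true) a
     (out ++ tVAR ++ pre ++ unary k.*2 ++ tSEP))) ->
  run phi (emit_var pre) (St o rd ans l r q y [::] d (nseq k true) a out)
    (k * 18 + size pre + 20) R.
Proof.
move=> HR; eapply run_le.
  eapply run_seq; eapply run_emit; eapply run_seq; eapply run_tally.
  eapply run_seq; eapply run_untally; eapply run_emit.
  by move: HR; rewrite -unary_double -!catA.
by rewrite size_cat /=; lia.
Qed.

Fixpoint emit_sizes n : cmd 8 S :=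
  if n is n'.+1 then
    emit (tSEP ++ tTICK) ;; tally tTICK ;; untally tTICK ;; emit_sizes n'
  else skip.

Lemma run_emit_sizes n k o rd ans q y d a out R :
  (forall o', R (St o' rd ans l r q y [::] d (nseq k true) a
     (out ++ flatten (nseq n (tSEP ++ unary k.*2.+1))))) ->
  run phi (emit_sizes n) (St o rd ans l r q y [::] d (nseq k true) a out)
    (n * (k * 18 + 19) + 1) R.
Proof.
elim: n o out => [|n IH] o out HR.
  by apply: run_do; move: (HR o); rewrite cats0.
eapply run_le.
  eapply run_seq; eapply run_emit; eapply run_seq; eapply run_tally.
  eapply run_seq; eapply run_untally; eapply IH.
  by move=> o'; move: (HR o'); rewrite unaryS -unary_double /= -!catA.
by rewrite mulSn /=; lia.
Qed.

Definition emit_y n :=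
  if n == 1 then emit tC0
  else emit (tVAR ++ tTICK ++ tSEP ++ tTICK) ;; tally tTICK ;; untally [::] ;; emit tSEP.

Lemma run_emit_y n k o rd ans q y d a out R :
  (forall o', R (St o' rd ans l r q y [::] d (nseq k true) a (out ++ enc_form (bit_y n k)))) ->
  run phi (emit_y n) (St o rd ans l r q y [::] d (nseq k true) a out) (k * 18 + 40) R.
Proof.
rewrite /emit_y /bit_y; case: (n == 1) => HR; eapply run_le.
- by eapply run_emit; apply: HR.
- by rewrite /=; lia.
- eapply run_seq; eapply run_emit; eapply run_seq; eapply run_tally.
  eapply run_seq; eapply run_untally; eapply run_emit.
  move: (HR None); rewrite (_ : flatten (nseq k [::]) = [::]) ?cats0; last by elim: (k).
  by rewrite -!catA.
- by rewrite /=; lia.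
Qed.

Definition pop_bit : cmd 8 S := Do (fun s => SPop (stack 7) (set_popped s)).

(** Prefix notation has no closing tokens, so a nested conjunction can be streamed. A unit is popped
    before the body runs, hence stack 6 then holds exactly the index of the current bit. *)
Definition cand_loop :=
  drain (stack 6)
    (pop_bit ;;
     emit_by 6 (fun s => tAND ++ (if bit s then [::] else tNOT)) ;;
     emit_var (tSEP ++ tTICK) ;;
     emit (tAND ++ tOR ++ tNOT ++ enc_form flag ++ tNOT) ;;
     emit_var (tSEP ++ tTICK ++ tTICK) ;; push (stack 5) true) ;;
  emit tC1.

Lemma run_cand_loop (s : seq bool) k o rd ans q y out R : size s = k ->
  R (St None rd ans l r q y [::] (nseq k true) [::] [::]
     (out ++ enc_form (cand_form s))) ->
  run phi cand_loop (St o rd ans l r q y [::] [::] (nseq k true) s out)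
    (k * (k * 36 + 150) + 10) R.
Proof.
move=> <- HR; apply: (@run_le _ _ _ _ _
  ((size (nseq (size s) true) * ((size s * 36 + 140) + 4) + 6) + 4)); last first.
  by rewrite size_nseq; lia.
apply: run_seq; apply: (@run_drain _ _ (fun z v => exists o s' d out',
   [/\ v = St o rd ans l r q y [::] (nseq d true) z s' out', z = nseq (size s') true,
       d + size s' = size s
     & out' ++ enc_form (cand_form s') = out ++ enc_form (cand_form s)])).
- by move=> z _ o' [? [s' [d [out' [-> Ez Ed Eo]]]]]; exists o', s', d, out'.
- move=> b z _ [o' [[|c s'] [d [out' [-> Ez Ed Eo]]]]] //; split=> //.
  case: Ez => -> ->; eapply run_le.
    eapply run_seq; eapply run_do => /=.
    eapply run_seq; eapply run_emit_by; eapply run_seq; eapply run_emit_var.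
    eapply run_seq; eapply run_emit; eapply run_seq; eapply run_emit_var.
    eapply run_do => /=; eexists; exists s', d.+1; eexists; split=> //.
      by rewrite -Ed /= addSnnS.
    rewrite -{}Eo take_oversize; last by case: (c).
    by case: (c); rewrite /bit /= -!catA /= -?catA.
  by rewrite /= in Ed *; lia.
- move=> _ [o' [[|c s'] [d [out' [-> Ez Ed Eo]]]]] //; split=> //=.
  apply: run_emit; move: HR; rewrite /= in Eo; rewrite -Eo -Ed addn0; exact.
- by exists o, s, 0, out; split.
Qed.

Definition lt_loop n :=
  drain (stack 6)
    (emit (tOR ++ tAND) ;; emit_var (tSEP ++ tTICK ++ tTICK) ;; emit tNOT ;; emit_y n ;;
     emit (tAND ++ tOR) ;; emit_var (tSEP ++ tTICK ++ tTICK) ;; emit tNOT ;; emit_y n ;;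
     push (stack 5) true) ;;
  emit tC0.

Lemma run_lt_loop n k o rd ans q y a out R :
  (R (St None rd ans l r q y [::] (nseq k true) [::] a (out ++ enc_form (lt_form n k)))) ->
  run phi (lt_loop n) (St o rd ans l r q y [::] [::] (nseq k true) a out)
    (k * (k * 72 + 250) + 10) R.
Proof.
move=> HR; apply: (@run_le _ _ _ _ _
  ((size (nseq k true) * ((k * 72 + 240) + 4) + 6) + 4)); last first.
  by rewrite size_nseq; lia.
apply: run_seq; apply: (@run_drain _ _ (fun z v => exists o j d out',
   [/\ v = St o rd ans l r q y [::] (nseq d true) z a out', z = nseq j true,
       d + j = k
     & out' ++ enc_form (lt_form n j) = out ++ enc_form (lt_form n k)])).
- by move=> z _ o' [? [j [d [out' [-> Ez Ed Eo]]]]]; exists o', j, d, out'.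
- move=> b z _ [o' [[|j] [d [out' [-> Ez Ed Eo]]]]] //; split=> //.
  case: Ez => -> ->; eapply run_le.
    eapply run_seq; eapply run_emit; eapply run_seq; eapply run_emit_var.
    eapply run_seq; eapply run_emit; eapply run_seq; eapply run_emit_y => o1.
    eapply run_seq; eapply run_emit; eapply run_seq; eapply run_emit_var.
    eapply run_seq; eapply run_emit; eapply run_seq; eapply run_emit_y => o2.
    eapply run_do => /=; eexists; exists j, d.+1; eexists; split=> //.
      by rewrite -Ed /= addSnnS.
    by rewrite -{}Eo /= -!catA /= -?catA.
  by rewrite /= in Ed *; lia.
- move=> _ [o' [[|j] [d [out' [-> Ez Ed Eo]]]]] //; split=> //=.
  apply: run_emit; move: HR; rewrite /= in Eo; rewrite -Eo -Ed addn0; exact.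
- by exists o, k, 0, out; split.
Qed.

Definition refill := drain (stack 5) (push (stack 6) true).

Lemma run_refill k o rd ans q y a out R :
  R (St None rd ans l r q y [::] [::] (nseq k true) a out) ->
  run phi refill (St o rd ans l r q y [::] (nseq k true) [::] a out) (k * 5 + 6) R.
Proof.
move=> HR; have -> : k * 5 + 6 = size (nseq k true) * (1 + 4) + 6 by rewrite size_nseq.
apply: (@run_drain _ _ (fun z v => exists o j, j + size z = k /\ v = St o rd ans l r q y [::] z (nseq j true) a out) 1).
- by move=> z _ o' [? [j [E ->]]]; exists o', j.
- move=> b z _ [o' [j [E ->]]]; split=> //; apply: run_do => /=.
  by exists (Some b), j.+1; split=> //; rewrite -E addSnnS.
- by move=> _ [o' [j [E ->]]]; split=> //=; rewrite -(addn0 j) E.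
- by exists o, 0; rewrite size_nseq.
Qed.

Definition usat_solver n :=
  load ;; bits_loop ;; emit_sizes n ;; emit tAND ;; cand_loop ;;
  emit (tAND ++ tOR ++ enc_form (pick_refute n) ++ tOR ++ enc_form flag ++ tNOT) ;;
  transducing refute_tr ;;
  emit (tOR ++ enc_form (pick_play n) ++ tOR ++ tNOT ++ tOR ++ enc_form flag) ;;
  refill ;; lt_loop n ;; transducing play_tr ;; ask ;;
  clear (stack 3) ;; clear (stack 5).

Lemma run_usat_solver n o rd ans y R :
  (forall o' rd' (s : seq bool) b, size s = size y ->
     (forall i, i < size y ->
        mem_p (phi (guarded_query (lead_eq i) y)) (nth false (rev s) i)) ->
     mem_p (phi (search_query n s y)) b ->
     R (St o' rd' b l r [::] [::] [::] [::] [::] [::] [::])) ->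
  run phi (usat_solver n) (St o rd ans l r (rev y) [::] [::] [::] [::] [::] [::])
    ((n * 100 + 1000) * (size y).+1 ^ 2) R.
Proof.
move=> HR; eapply run_le.
  eapply run_seq; eapply run_load_query.
  eapply run_seq; eapply run_bits_loop => rd1 ans1 s Es Hs.
  eapply run_seq; eapply run_emit_sizes => o1.
  eapply run_seq; eapply run_emit.
  eapply run_seq; eapply run_cand_loop; first exact: Es.
  eapply run_seq; eapply run_emit.
  eapply run_seq; eapply run_transducing; first exact: refute_tr_small.
  move=> rd2; eapply run_seq; eapply run_emit.
  eapply run_seq; eapply run_refill; eapply run_seq; eapply run_lt_loop.
  eapply run_seq; eapply run_transducing; first exact: play_tr_small.
  move=> rd3; eapply run_seq; eapply run_do => /= b Hb.
  eapply run_seq; eapply run_clear3; eapply run_clear5.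
  apply: (HR _ _ _ _ Es Hs); congr (mem_p (phi _) b): Hb.
  by rewrite /search_query Es -!catA /= -!catA.
rewrite !size_cat size_nseq.
have [] : size (enc_form (pick_refute n)) <= 20 /\ size (enc_form (pick_play n)) <= 20.
  by rewrite /pick_refute /pick_play; case: (n == 1).
move: (size _) (size (enc_form (pick_play n))) (size y) => p p' D /= le_p le_p'.
rewrite expnS expn1.
have : n * (D * 18 + 19) <= n * 100 * (D.+1 * D.+1) by nia.
nia.
Qed.


End Straight.
End Programs.

Lemma uval_solver_solves n : 0 < n ->
  @solves regs uval_solver (fun m => m.2) (UVAL n) (USAT n) (fun k => 100 * k.+1).
Proof.
move=> n0 X x [[o rd] ans] inp l r y; apply: run_uval_solver => o' rd' b Hb.
by exists (o', rd', b) => //; apply: UVAL_of_USAT_query Hb.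
Qed.

Lemma usat_solver_solves n : 0 < n ->
  @solves regs (fun X => usat_solver X n) (fun m => m.2) (USAT n) (UVAL n)
    (fun k => (n * 100 + 1000) * k.+1 ^ 2).
Proof.
move=> n0 X x [[o rd] ans] inp l r y.
apply: run_usat_solver => o' rd' s b Es Hs Hb.
by exists (o', rd', b) => //; apply: USAT_of_UVAL_query Es Hs Hb.
Qed.

Theorem theorem12 (n : nat) (hn : 1 <= n) :
  forall phi1 : promise, Phat (UVAL n) phi1 <-> Phat (USAT n) phi1.
Proof.
pose m0 : regs := (None, (None, None), false).
move=> phi1; split.
- apply: (reduces_solves m0 (uval_solver_solves hn)) => [i j le_ij|].
    by rewrite leq_mul2l ltnS le_ij.
  by exists 100, 1 => k; rewrite expn1.
- apply: (reduces_solves m0 (usat_solver_solves hn)) => [i j le_ij|].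
    by rewrite leq_mul2l leq_exp2r // ltnS le_ij orbT.
  by exists (n * 100 + 1000), 2.
Qed.
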